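(* Let $b\ge2$ be a prime power. For each integer $m\ge1$ put $N=b^m$, let $P_N=\{x_0,\ldots,x_{N-1}\}\subseteq[0,1]^2$ be a digital $(0,m,2)$-net in base $b$, and let $Z_N=\Phi(P_N)$, i.e. $Z_N$ consists of the points $z_n=\Phi(x_n)\in\mathbb{S}^2$, $0\le n<N$. Then the equal weight quadrature rules $Q_N(f)=\frac1N\sum_{n=0}^{N-1}f(z_n)$ associated with $Z_N$ satisfy $$e^2(Q_N,\mathcal{H}^{3/2})=\mathcal{O}(N^{-1}\log N)\qquad\text{as }N\to\infty.$$
   Context: $\mathbb{S}^2$ is the unit sphere in $\mathbb{R}^3$, $\sigma_2$ is its normalized surface area measure ($\sigma_2(\mathbb{S}^2)=1$), $\|\cdot\|$ is the Euclidean norm. Lifting map: $\Phi:[0,1]^2\to\mathbb{S}^2$, $\Phi(x_1,x_2)=\left(2\cos(2\pi x_1)\sqrt{x_2-x_2^2},\;2\sin(2\pi x_1)\sqrt{x_2-x_2^2},\;1-2x_2\right)$. Nets: a point set $P\subseteq[0,1)^2$ consisting of $b^m$ points is a $(0,m,2)$-net in base $b$ if for all nonnegative integers $d_1,d_2$ with $d_1+d_2=m$ and all integers $0\le a_i<b^{d_i}$ ($i=1,2$), the interval $\prod_{i=1}^2\left[\frac{a_i}{b^{d_i}},\frac{a_i+1}{b^{d_i}}\right)$ contains exactly one point of $P$. Digital nets: let $\mathbb{F}_b$ be the finite field with $b$ elements ($\mathbb{Z}_b$ if $b$ is prime), identified with $\{0,\ldots,b-1\}$ by a fixed bijection. Given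 matrices $C_1,C_2\in\mathbb{F}_b^{m\times m}$, for $0\le n<b^m$ write $n=n_0+n_1b+\cdots+n_{m-1}b^{m-1}$ in base $b$, let $\vec n=(n_0,\ldots,n_{m-1})^\top\in\mathbb{F}_b^m$, $\vec y_{n,i}=C_i\vec n=(y_{n,i,1},\ldots,y_{n,i,m})^\top$ and $x_{n,i}=\frac{y_{n,i,1}}{b}+\cdots+\frac{y_{n,i,m}}{b^m}$ for $i=1,2$. The point set $\{(x_{n,1},x_{n,2}):0\le n<b^m\}$ is a digital net; it is a digital $(0,m,2)$-net in base $b$ if it is also a $(0,m,2)$-net in base $b$. Worst-case error: $\mathcal{H}^{3/2}$ is the reproducing kernel Hilbert space of functions on $\mathbb{S}^2$ with kernel $K(z,z')=\frac83-\|z-z'\|$, and $e(Q_N,\mathcal{H}^{3/2})=\sup\left\{\left|Q_N(f)-\int_{\mathbb{S}^2}f\,\mathrm{d}\sigma_2\right|:f\in\mathcal{H}^{3/2},\ \|f\|_{\mathcal{H}^{3/2}}\le1\right\}$. Its square $e^2(Q_N,\mathcal{H}^{3/2})$ is given by $e^2(Q_N,\mathcal{H}^{3/2})=\frac43-\frac1{N^2}\sum_{k,\ell=0}^{N-1}\|z_k-z_\ell\|$, where $\frac43=\int_{\mathbb{S}^2}\int_{\mathbb{S}^2}\|z-z'\|\,\mathrm{d}\sigma_2(z)\,\mathrm{d}\sigma_2(z')$. *)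

(* Defs.v *)
From HB Require Import structures.
From mathcomp Require Import all_boot all_order all_algebra.
From mathcomp Require Import all_classical all_reals all_analysis.
Import Order.TTheory GRing.Theory Num.Theory.
Import numFieldNormedType.Exports.

Set Implicit Arguments.
Unset Strict Implicit.
Unset Printing Implicit Defensive.

Local Open Scope classical_set_scope.
Local Open Scope ring_scope.

Definition prime_power (b : nat) : Prop :=
  exists p k : nat, [/\ prime p, (0 < k)%N & b = (p ^ k)%N].

(* The library norm on 'rV[R]_3 is the maximum norm, hence this definition. *)
Definition enorm (R : realType) (z : 'rV[R]_3) : R :=
  Num.sqrt (\sum_(i < 3) z 0 i ^+ 2).

Definition vec3 (R : realType) (x y z : R) : 'rV[R]_3 :=
  \row_(i < 3) [:: x; y; z]`_i.

Definition sphere (R : realType) : set 'rV[R]_3 := [set z | enorm z = 1].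

Definition lift_sphere (R : realType) (x : R * R) : 'rV[R]_3 :=
  vec3 (2 * cos (2 * pi * x.1) * Num.sqrt (x.2 - x.2 ^+ 2))
       (2 * sin (2 * pi * x.1) * Num.sqrt (x.2 - x.2 ^+ 2))
       (1 - 2 * x.2).

Definition spherical (R : realType) (theta phi : R) : 'rV[R]_3 :=
  vec3 (sin theta * cos phi) (sin theta * sin phi) (cos theta).

(* The integral of f against the normalized surface area measure of the unit
   sphere: in spherical coordinates (colatitude theta, longitude phi) the area
   element is sin theta dtheta dphi, and the total area is 4 pi. *)
Definition sphere_integral (R : realType) (f : 'rV[R]_3 -> R) : R :=
  (4 * pi)^-1 *
  \int[@lebesgue_measure R]_(phi in `[0, 2 * pi])
    \int[@lebesgue_measure R]_(theta in `[0, pi])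
      (f (spherical theta phi) * sin theta).

(* The reproducing kernel Hilbert space of real functions on D with kernel K:
   a Banach space whose norm comes from an inner product, and whose elements f
   are identified, through the injective linear map rkhs_eval, with functions
   on D (the values of rkhs_eval f outside D are irrelevant).  The function
   K(., x) is rkhs_repr x for x in D.  Such a space is determined by D and K
   up to an isometric isomorphism compatible with evaluation. *)
Record rkhs (R : realType) (T : Type) (D : set T) (K : T -> T -> R) := Rkhs {
  rkhs_space :> completeNormedModType R;
  rkhs_inner : {biscalar rkhs_space};
  rkhs_eval : rkhs_space -> T -> R;
  rkhs_repr : T -> rkhs_space;
  rkhs_innerC : forall f g, rkhs_inner f g = rkhs_inner g f;
  rkhs_normE : forall f, rkhs_inner f f = `|f| ^+ 2;
  rkhs_eval_linear : forall a f g x, D x ->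
    rkhs_eval (a *: f + g) x = a * rkhs_eval f x + rkhs_eval g x;
  rkhs_eval_inj : forall f g,
    (forall x, D x -> rkhs_eval f x = rkhs_eval g x) -> f = g;
  rkhs_reprE : forall x y, D x -> D y -> rkhs_eval (rkhs_repr x) y = K y x;
  rkhs_reproducing : forall f x, D x ->
    rkhs_eval f x = rkhs_inner f (rkhs_repr x)
}.

Definition distance_kernel (R : realType) (z w : 'rV[R]_3) : R :=
  8 / 3 - enorm (z - w).

Definition quadrature (R : realType) (N : nat) (z : nat -> 'rV[R]_3)
    (f : 'rV[R]_3 -> R) : R :=
  N%:R^-1 * \sum_(0 <= n < N) f (z n).

(* Taken in the extended reals, where an unbounded set has supremum +oo. *)
Definition worst_case_error (R : realType)
    (H : rkhs (@sphere R) (@distance_kernel R))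
    (Q : ('rV[R]_3 -> R) -> R) : \bar R :=
  ereal_sup [set `|Q (rkhs_eval f) - sphere_integral (rkhs_eval f)|%:E
            | f in [set f : H | `|f| <= 1]].

Definition is_net (R : realType) (b m : nat) (P : set (R * R)) : Prop :=
  [/\ P `<=` [set x | 0 <= x.1 < 1 /\ 0 <= x.2 < 1],
      (P #= `I_(b ^ m)%N)%card
    & forall d1 d2 a1 a2 : nat,
        (d1 + d2 = m)%N -> (a1 < b ^ d1)%N -> (a2 < b ^ d2)%N ->
        exists! x : R * R, P x /\
          (a1%:R / (b ^ d1)%:R <= x.1 < a1.+1%:R / (b ^ d1)%:R /\
           a2%:R / (b ^ d2)%:R <= x.2 < a2.+1%:R / (b ^ d2)%:R)].

(* An identification of F with {0, ..., b - 1}; the values of decode at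
   arguments d >= b are irrelevant. *)
Definition digit_bijection (b : nat) (F : Type)
    (code : F -> nat) (decode : nat -> F) : Prop :=
  [/\ forall a, (code a < b)%N, cancel code decode
    & forall d, (d < b)%N -> code (decode d) = d].

Definition digit_vector (b : nat) (F : Type) (decode : nat -> F)
    (m n : nat) : 'cV[F]_m :=
  \col_(j < m) decode ((n %/ b ^ j) %% b)%N.

Definition digital_coord (R : realType) (b : nat) (F : finFieldType)
    (code : F -> nat) (decode : nat -> F)
    (m : nat) (C : 'M[F]_m) (n : nat) : R :=
  \sum_(k < m) (code ((C *m digit_vector b decode m n) k 0))%:R / b%:R ^+ k.+1.

Definition digital_point (R : realType) (b : nat) (F : finFieldType)
    (code : F -> nat) (decode : nat -> F)
    (m : nat) (C1 C2 : 'M[F]_m) (n : nat) : R * R :=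
  (digital_coord R b code decode C1 n, digital_coord R b code decode C2 n).

Definition digital_set (R : realType) (b : nat) (F : finFieldType)
    (code : F -> nat) (decode : nat -> F)
    (m : nat) (C1 C2 : 'M[F]_m) : set (R * R) :=
  [set digital_point R b code decode C1 C2 n | n in `I_(b ^ m)%N].

(* Main.v *)
Require Import Defs.
From HB Require Import structures.
From mathcomp Require Import all_boot all_order all_algebra.
From mathcomp Require Import ring lra zify.
From mathcomp Require Import all_classical all_reals all_analysis.
Import Order.TTheory GRing.Theory Num.Theory.
Import numFieldNormedType.Exports.
Local Open Scope classical_set_scope.
Local Open Scope ring_scope.

(** Only the elementary intervals of one shape are needed. With
    A = b^(m/2) and B = b^(m - m/2), each cell of the A x B grid of the square
    contains exactly one net point z_k. Let w_k be points of the same cells at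
    which f is almost minimal; as the lifting map preserves area,
    Q_N(f) - int f <= (1/N) sum_k (f(z_k) - f(w_k)) up to an arbitrarily small
    error, and the opposite bound follows by applying this to -f. By the
    reproducing property and Cauchy-Schwarz, the square of the right-hand side
    is at most (1/N^2) sum_(k,l) |Delta_kl|, where Delta_kl is the mixed second
    difference of the Euclidean distance for the pairs (z_k, w_k) and
    (z_l, w_l).

    If r_k is the diameter of the lifted k-th cell and d_kl the distance of z_k
    and z_l, then |Delta_kl| <= 2 min (r_k, r_l) and
    |Delta_kl| <= 4 r_k r_l / d_kl. The first bound suffices for cells in
    adjacent columns and for cells touching a pole, since there are few such
    pairs. In the other cases d_kl >= 2 sqrt (rho_k rho_l) |sin (pi u)|, with
    rho the radii of the parallels and u the difference of the longitudes
    divided by 2 pi, so that the sum factors into sums over rows, which are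
    bounded, and a harmonic sum over columns, which gives the logarithm. *)

Set Implicit Arguments.
Unset Strict Implicit.
Unset Printing Implicit Defensive.

(** * The Euclidean distance and its mixed differences *)

Lemma enormE (R : realType) (z : 'rV[R]_3) :
  enorm z = Num.sqrt (z 0 0 ^+ 2 + z 0 1 ^+ 2 + z 0 2 ^+ 2).
Proof.
rewrite /enorm !big_ord_recr big_ord0 /= add0r.
by do ![congr Num.sqrt | congr +%R | congr (_ ^+ _) | congr fun_of_matrix];
  apply: val_inj.
Qed.

Lemma enorm_ge0 (R : realType) (z : 'rV[R]_3) : 0 <= enorm z.
Proof. exact: sqrtr_ge0. Qed.

Lemma enorm_sqr (R : realType) (z : 'rV[R]_3) :
  enorm z ^+ 2 = z 0 0 ^+ 2 + z 0 1 ^+ 2 + z 0 2 ^+ 2.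
Proof. by rewrite enormE sqr_sqrtr// !addr_ge0// sqr_ge0. Qed.

Lemma enormN (R : realType) (z : 'rV[R]_3) : enorm (- z) = enorm z.
Proof. by rewrite !enormE !mxE !sqrrN. Qed.

Lemma enormB (R : realType) (z w : 'rV[R]_3) : enorm (z - w) = enorm (w - z).
Proof. by rewrite -enormN opprB. Qed.

Definition dot3 (R : realType) (u v : 'rV[R]_3) : R :=
  u 0 0 * v 0 0 + u 0 1 * v 0 1 + u 0 2 * v 0 2.

Lemma dot3_le (R : realType) (u v : 'rV[R]_3) :
  `|dot3 u v| <= enorm u * enorm v.
Proof.
rewrite -(@ler_pXn2r _ 2) ?nnegrE ?mulr_ge0 ?enorm_ge0//.
rewrite real_normK ?num_real// exprMn !enorm_sqr /dot3 -subr_ge0.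
set a := u 0 0; set b := u 0 1; set c := u 0 2.
set x := v 0 0; set y := v 0 1; set z := v 0 2.
have -> : (a ^+ 2 + b ^+ 2 + c ^+ 2) * (x ^+ 2 + y ^+ 2 + z ^+ 2) -
    (a * x + b * y + c * z) ^+ 2 =
    (a * y - b * x) ^+ 2 + (a * z - c * x) ^+ 2 + (b * z - c * y) ^+ 2.
  by ring.
by rewrite !addr_ge0// sqr_ge0.
Qed.

Lemma enormD (R : realType) (u v : 'rV[R]_3) :
  enorm (u + v) <= enorm u + enorm v.
Proof.
rewrite -(@ler_pXn2r _ 2) ?nnegrE ?addr_ge0 ?enorm_ge0//.
have -> : enorm (u + v) ^+ 2 = enorm u ^+ 2 + enorm v ^+ 2 + 2 * dot3 u v.
  by rewrite !enorm_sqr !mxE /dot3; ring.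
have := ler_norm (dot3 u v); have := dot3_le u v.
rewrite sqrrD; lra.
Qed.

Lemma enorm_dist (R : realType) (u v : 'rV[R]_3) :
  `|enorm u - enorm v| <= enorm (u - v).
Proof.
have := enormD (u - v) v; have := enormD (v - u) u.
by rewrite !subrK [enorm (v - u)]enormB ler_norml; lra.
Qed.

(** The constant of the kernel cancels in second differences, so up to sign this is the inner
    product of the differences of representers at [a], [a'] and at [b], [b']. *)
Definition mixdiff (R : realType) (a a' b b' : 'rV[R]_3) : R :=
  enorm (a - b) - enorm (a - b') - enorm (a' - b) + enorm (a' - b').

Lemma mixdiff_le_l (R : realType) (a a' b b' : 'rV[R]_3) :
  `|mixdiff a a' b b'| <= 2 * enorm (a - a').
Proof.
have := enorm_dist (a - b) (a' - b); have := enorm_dist (a - b') (a' - b').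
have E c : a - c - (a' - c) = a - a' by rewrite opprB addrA subrK.
rewrite !E /mixdiff !ler_norml => /andP[? ?] /andP[? ?]; apply/andP; split; lra.
Qed.

Lemma mixdiffC (R : realType) (a a' b b' : 'rV[R]_3) :
  mixdiff a a' b b' = mixdiff b b' a a'.
Proof.
rewrite /mixdiff (enormB b a) (enormB b a') (enormB b' a) (enormB b' a').
by ring.
Qed.

Lemma mixdiff_le_r (R : realType) (a a' b b' : 'rV[R]_3) :
  `|mixdiff a a' b b'| <= 2 * enorm (b - b').
Proof. by rewrite mixdiffC mixdiff_le_l. Qed.

(* With p, q, r, s the four distances,
   p - q - r + s = (p^2 - q^2 - r^2 + s^2) / (p + q)
                   + (r - s) (r + s - p - q) / (p + q),
   and the first numerator is - 2 <a - a', b - b'>. *)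
Lemma mixdiff_le (R : realType) (a a' b b' : 'rV[R]_3) :
  enorm (a - b) * `|mixdiff a a' b b'| <= 4 * (enorm (a - a') * enorm (b - b')).
Proof.
rewrite /mixdiff; set p := enorm (a - b); set q := enorm (a - b').
set r := enorm (a' - b); set s := enorm (a' - b').
set d := enorm (a - a'); set e := enorm (b - b').
have p0 : 0 <= p := enorm_ge0 _; have q0 : 0 <= q := enorm_ge0 _.
have d0 : 0 <= d := enorm_ge0 _; have e0 : 0 <= e := enorm_ge0 _.
have pr : `|r - p| <= d.
  have := enorm_dist (a - b) (a' - b).
  by rewrite opprB addrA subrK distrC.
have qs : `|s - q| <= d.
  have := enorm_dist (a - b') (a' - b').
  by rewrite opprB addrA subrK distrC.
have rs : `|r - s| <= e.
  have E : a' - b - (a' - b') = b' - b by rewrite opprB addrC addrA subrK.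
  by have := enorm_dist (a' - b) (a' - b'); rewrite E (enormB b').
have dt : p ^+ 2 - q ^+ 2 - r ^+ 2 + s ^+ 2 = - (2 * dot3 (a - a') (b - b')).
  by rewrite /p /q /r /s !enorm_sqr /dot3 !mxE; ring.
have D := dot3_le (a - a') (b - b').
(* Enlarging p to p + q clears the denominator; the two numerators then contribute at most 2 d e
   each. *)
apply: (@le_trans _ _ ((p + q) * `|p - q - r + s|)).
  by rewrite ler_wpM2r// lerDl.
rewrite -[p + q in X in X <= _]ger0_norm ?addr_ge0// -normrM.
have -> : (p + q) * (p - q - r + s) =
    - (2 * dot3 (a - a') (b - b')) + (r - s) * ((r - p) + (s - q)).
  by rewrite -dt; ring.
apply: (le_trans (ler_normD _ _)).
rewrite normrN !normrM ger0_norm//.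
have : `|r - s| * `|r - p + (s - q)| <= e * (d + d).
  apply: ler_pM => //.
  by apply: (le_trans (ler_normD _ _)); apply: lerD.
by move: D; rewrite -/d -/e; lra.
Qed.

(** * Estimates in the reproducing kernel Hilbert space *)

Lemma rkhs_CS (R : realType) (T : Type) (D : set T) (K : T -> T -> R)
  (H : rkhs D K) (f g : H) : rkhs_inner H f g ^+ 2 <= `|f| ^+ 2 * `|g| ^+ 2.
Proof.
have [->|g0] := eqVneq g 0.
  by rewrite linear0r normr0 !expr0n/= mulr0.
have G : 0 < `|g| ^+ 2 by rewrite exprn_gt0// normr_gt0.
set c := rkhs_inner H f g.
(* This square norm expands to |g|^2 (|f|^2 |g|^2 - c^2). *)
have : 0 <= rkhs_inner H (`|g| ^+ 2 *: f - c *: g) (`|g| ^+ 2 *: f - c *: g).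
  by rewrite rkhs_normE sqr_ge0.
have Zl (a : R) u v : rkhs_inner H (a *: u) v = a * rkhs_inner H u v :> R.
  by rewrite linearZl_LR.
have Zr (a : R) u v : rkhs_inner H u (a *: v) = a * rkhs_inner H u v :> R.
  by rewrite linearZr_LR.
rewrite linearBl !linearBr !Zl !Zr !rkhs_normE (rkhs_innerC g f) -/c.
set a := `|f| ^+ 2; set b := `|g| ^+ 2.
set L := (X in 0 <= X -> _); have -> : L = b * (a * b - c ^+ 2).
  by rewrite /L; ring.
by rewrite (pmulr_rge0 _ G) subr_ge0.
Qed.

(** The sum on the left is the inner product of [f] with the sum [g] of differences of representers,
    and the square norm of [g] expands into minus the mixed differences. *)
Lemma rkhs_sum_le (R : realType) (H : rkhs (@sphere R) (@distance_kernel R))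
  (I : finType) (z w : I -> 'rV[R]_3) (f : H) :
  (forall k, sphere (z k)) -> (forall k, sphere (w k)) ->
  (\sum_k (rkhs_eval f (z k) - rkhs_eval f (w k))) ^+ 2 <=
  `|f| ^+ 2 * \sum_k \sum_l `|mixdiff (z k) (w k) (z l) (w l)|.
Proof.
move=> sz sw; set g := \sum_k (rkhs_repr H (z k) - rkhs_repr H (w k)).
have -> : \sum_k (rkhs_eval f (z k) - rkhs_eval f (w k)) = rkhs_inner H f g.
  rewrite linear_sumr; apply: eq_bigr => k _.
  by rewrite linearBr /= !rkhs_reproducing.
apply: (le_trans (rkhs_CS f g)); rewrite ler_wpM2l ?sqr_ge0//.
rewrite -rkhs_normE {1}/g linear_sumlz ler_sum// => k _.
rewrite linear_sumr ler_sum// => l _.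
rewrite linearBl !linearBr /= -!rkhs_reproducing// !rkhs_reprE//.
rewrite /distance_kernel; apply: (le_trans (ler_norm _)); rewrite -normrN.
rewrite /mixdiff (enormB (z l) (z k)) (enormB (z l) (w k)).
rewrite (enormB (w l) (z k)) (enormB (w l) (w k)).
by set E := (X in `|X| <= _); set E' := (X in _ <= `|X|);
  have -> : E = E' by rewrite /E /E'; ring.
Qed.

(** The one-term case of [rkhs_sum_le]: Hölder continuity of exponent 1/2, from which all integrands
    below are continuous, hence integrable. *)
Lemma rkhs_holder (R : realType) (H : rkhs (@sphere R) (@distance_kernel R))
  (f : H) (z w : 'rV[R]_3) : sphere z -> sphere w ->
  (rkhs_eval f z - rkhs_eval f w) ^+ 2 <= `|f| ^+ 2 * (2 * enorm (z - w)).
Proof.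
move=> sz sw.
have := @rkhs_sum_le R H 'I_1 (fun=> z) (fun=> w) f (fun=> sz) (fun=> sw).
rewrite !big_ord1 => /le_trans; apply; rewrite ler_wpM2l ?sqr_ge0//.
exact: mixdiff_le_l.
Qed.

(** Cauchy-Schwarz against the representer, whose square norm is the diagonal value of the kernel.
    It makes the infima over cells finite. *)
Lemma rkhs_bounded (R : realType) (H : rkhs (@sphere R) (@distance_kernel R))
  (f : H) (z : 'rV[R]_3) : sphere z ->
  `|rkhs_eval f z| <= `|f| * Num.sqrt (8 / 3).
Proof.
move=> sz; rewrite rkhs_reproducing//.
rewrite -(@ler_pXn2r _ 2) ?nnegrE ?mulr_ge0 ?sqrtr_ge0//.
rewrite real_normK ?num_real// exprMn sqr_sqrtr ?divr_ge0//.
apply: (le_trans (rkhs_CS _ _)); rewrite ler_wpM2l ?sqr_ge0//.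
rewrite -rkhs_normE -rkhs_reproducing// rkhs_reprE// /distance_kernel subrr.
by rewrite lerBlDr lerDl enorm_ge0.
Qed.

(** * The lifting map *)

Lemma sin_mean_value (R : realType) (a b : R) : a <= b ->
  exists2 c, c \in `[a, b] & sin b - sin a = cos c * (b - a).
Proof.
by move=> ab; apply/(MVT_segment ab)/continuous_subspaceT/continuous_sin.
Qed.

Lemma norm_sin_le (R : realType) (x : R) : `|sin x| <= `|x|.
Proof.
wlog x0 : x / 0 <= x => [hw|].
  have [/hw//|/ltW x0] := leP 0 x.
  by rewrite -normrN -sinN -(normrN x) hw// oppr_ge0.
have [c _] := sin_mean_value x0; rewrite sin0 !subr0 => ->.
by rewrite normrM ler_piMl// cos_max.
Qed.

Lemma cos_ge_quadratic (R : realType) (x : R) : 1 - x ^+ 2 / 2 <= cos x.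
Proof.
have -> : cos x = cos ((x / 2) *+ 2) by rewrite -mulr_natr divfK.
rewrite cos_mulr2n cos2sin2.
have : sin (x / 2) ^+ 2 <= (x / 2) ^+ 2.
  by rewrite -[leLHS]real_normK ?num_real// -[leRHS]real_normK ?num_real//
    ler_pXn2r ?nnegrE// norm_sin_le.
lra.
Qed.

Lemma sin_ge_half (R : realType) (x : R) : 0 <= x <= 1 -> x / 2 <= sin x.
Proof.
move=> /andP[x0 x1].
have [c] := sin_mean_value x0.
rewrite sin0 !subr0 in_itv/= => /andP[c0 cx] ->.
rewrite mulrC ler_wpM2r//.
apply: le_trans (cos_ge_quadratic c).
have : c ^+ 2 <= 1 by rewrite expr_le1// (le_trans cx).
lra.
Qed.

(** Up to pi u = 1, [sin_ge_half] and pi >= 2 suffice; beyond, sin is still increasing, so its value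
    is at least sin 1 >= 1/2 >= u. *)
Lemma sin_pi_ge (R : realType) (u : R) : 0 <= u <= 1 / 2 -> u <= sin (pi * u).
Proof.
move=> /andP[u0 u2]; have pi2 := pi_ge2 R.
have pu0 : 0 <= pi * u by rewrite mulr_ge0// pi_ge0.
have [pu1|/ltW pu1] := leP (pi * u) 1.
  by apply: le_trans (sin_ge_half _); [nra|rewrite pu0].
have : sin 1 <= sin (pi * u).
  rewrite leNgt ltr_sin ?in_itv/= -?leNgt//; last by apply/andP; split; nra.
  by apply/andP; split; nra.
have : 1 / 2 <= sin (1 : R) by apply: sin_ge_half; rewrite ler01 lexx.
lra.
Qed.

(** By the symmetry of sin about pi / 2, sin (pi u) is at least min (u, 1 - u). The sum of both
    reciprocals avoids a case distinction and later gives two harmonic sums. *)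
Lemma inv_sin_pi_le (R : realType) (u : R) :
  0 < u < 1 -> (sin (pi * u))^-1 <= u^-1 + (1 - u)^-1.
Proof.
move=> /andP[u0 u1].
have [u2|/ltW u2] := leP u (1 / 2).
  have su : u <= sin (pi * u) by apply: sin_pi_ge; rewrite ltW.
  apply: (@le_trans _ _ u^-1); last by rewrite lerDl invr_ge0 subr_ge0 ltW.
  by rewrite lef_pV2 ?posrE// (lt_le_trans u0).
have su : 1 - u <= sin (pi * u).
  have -> : pi * u = pi - pi * (1 - u) by ring.
  by rewrite sinB sinpi cospi mul0r sub0r mulN1r opprK sin_pi_ge//; lra.
have u10 : 0 < 1 - u by lra.
apply: (@le_trans _ _ (1 - u)^-1); last by rewrite lerDr invr_ge0 ltW.
by rewrite lef_pV2 ?posrE// (lt_le_trans u10).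
Qed.

Lemma cos_sinsq (R : realType) (x y : R) :
  cos x * cos y + sin x * sin y = 1 - 2 * sin ((x - y) / 2) ^+ 2.
Proof.
have -> : cos x * cos y + sin x * sin y = cos (((x - y) / 2) *+ 2).
  by rewrite -mulr_natr divfK// cosB.
rewrite cos_mulr2n cos2sin2; ring.
Qed.

(* The radius of the parallel of height 1 - 2 t. *)
Definition parallel (R : realType) (t : R) : R := 2 * Num.sqrt (t - t ^+ 2).

Lemma parallel_ge0 (R : realType) (t : R) : 0 <= parallel t.
Proof. by rewrite mulr_ge0// sqrtr_ge0. Qed.

Lemma parallel_sqr (R : realType) (t : R) : 0 <= t <= 1 ->
  parallel t ^+ 2 = 4 * (t * (1 - t)).
Proof. by move=> t01; rewrite exprMn sqr_sqrtr; [ring|nra]. Qed.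

Lemma parallel_le1 (R : realType) (t : R) : 0 <= t <= 1 -> parallel t <= 1.
Proof.
move=> t01; rewrite -(@expr_le1 _ 2)// ?parallel_ge0// parallel_sqr//.
have := sqr_ge0 (2 * t - 1); lra.
Qed.

Lemma lift_sphere_on (R : realType) (x : R * R) :
  0 <= x.2 <= 1 -> sphere (lift_sphere x).
Proof.
move=> hx; rewrite /sphere /= enormE !mxE /=.
set t := Num.sqrt (x.2 - _); set c := cos _; set s := sin _.
have ht : t ^+ 2 = x.2 - x.2 ^+ 2 by rewrite sqr_sqrtr; [|nra].
have hc : c ^+ 2 + s ^+ 2 = 1 by exact: cos2Dsin2.
have -> : (2 * c * t) ^+ 2 + (2 * s * t) ^+ 2 + (1 - 2 * x.2) ^+ 2 =
  4 * t ^+ 2 * (c ^+ 2 + s ^+ 2) + (1 - 2 * x.2) ^+ 2 by ring.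
by rewrite ht hc -[RHS]sqrtr1; congr Num.sqrt; ring.
Qed.

(** The law of cosines in the horizontal plane, with 1 - cos written as twice the squared sine of
    the half angle; the last term comes from the heights. *)
Lemma lift_sphere_dist (R : realType) (x y : R * R) :
  let r := parallel x.2 in let s := parallel y.2 in
  enorm (lift_sphere x - lift_sphere y) ^+ 2 =
  (r - s) ^+ 2 + 4 * (r * s * sin (pi * (x.1 - y.1)) ^+ 2)
  + 4 * (x.2 - y.2) ^+ 2.
Proof.
rewrite /parallel enorm_sqr !mxE /=.
have := cos_sinsq (2 * pi * x.1) (2 * pi * y.1).
have -> : (2 * pi * x.1 - 2 * pi * y.1) / 2 = pi * (x.1 - y.1) :> R by field.
have := cos2Dsin2 (2 * pi * x.1); have := cos2Dsin2 (2 * pi * y.1).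
set c := cos _; set s := sin _; set c' := cos _; set s' := sin _.
set t := Num.sqrt _; set t' := Num.sqrt _; set z := sin _.
move=> e' e h.
have -> : (2 * c' * t - 2 * c * t') ^+ 2 + (2 * s' * t - 2 * s * t') ^+ 2 +
    (1 - 2 * x.2 - (1 - 2 * y.2)) ^+ 2 =
  4 * t ^+ 2 * (c' ^+ 2 + s' ^+ 2) + 4 * t' ^+ 2 * (c ^+ 2 + s ^+ 2)
  - 8 * (t * t' * (c' * c + s' * s)) + 4 * (x.2 - y.2) ^+ 2 by ring.
by rewrite e e' h; ring.
Qed.

Lemma lift_sphere_dist_le (R : realType) (x y : R * R) :
  0 <= x.2 <= 1 -> 0 <= y.2 <= 1 ->
  enorm (lift_sphere x - lift_sphere y) <=
  `|parallel x.2 - parallel y.2| + 8 * `|x.1 - y.1| + 2 * `|x.2 - y.2|.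
Proof.
move=> hx hy.
rewrite -(@ler_pXn2r _ 2) ?nnegrE ?enorm_ge0 ?addr_ge0 ?mulr_ge0//.
rewrite lift_sphere_dist /=.
have := norm_sin_le (pi * (x.1 - y.1)).
set r := parallel _; set s := parallel _; set z := sin _.
rewrite normrM (ger0_norm (pi_ge0 R)).
(* This crude bound turns the Lipschitz constant 2 pi in longitude into 8. *)
have pi4 : pi <= 4 :> R.
  by have [/andP[_]] := pihalf_02_cos_pihalf R; rewrite ler_pdivrMr; lra.
rewrite -[(r - s) ^+ 2]real_normK ?num_real// -[z ^+ 2]real_normK ?num_real//.
rewrite -[(x.2 - y.2) ^+ 2]real_normK ?num_real//.
have := normr_ge0 (r - s); have := normr_ge0 (x.2 - y.2).
have := normr_ge0 (x.1 - y.1); have := normr_ge0 z.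
set a := `|r - s|; set b := `|z|; set c := `|x.1 - y.1|; set d := `|x.2 - y.2|.
move=> b0 c0 d0 a0 bc.
have rs : r * s <= 1.
  by rewrite mulr_ile1 ?parallel_ge0 ?parallel_le1.
have rs0 : 0 <= r * s by rewrite mulr_ge0 ?parallel_ge0.
have b4 : b <= 4 * c by apply: (le_trans bc); rewrite ler_wpM2r.
have B : r * s * b ^+ 2 <= 16 * c ^+ 2.
  apply: (@le_trans _ _ (b ^+ 2)); first by rewrite ler_piMl// sqr_ge0.
  rewrite (_ : 16 * c ^+ 2 = (4 * c) ^+ 2); last by ring.
  by rewrite ler_pXn2r ?nnegrE ?mulr_ge0.
have : 0 <= a * c /\ 0 <= a * d /\ 0 <= c * d by rewrite !mulr_ge0.
by move=> [? [? ?]]; lra.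
Qed.

Lemma lift_sphere_dist_ge (R : realType) (x y : R * R) :
  2 * Num.sqrt (parallel x.2 * parallel y.2) * `|sin (pi * (x.1 - y.1))| <=
  enorm (lift_sphere x - lift_sphere y).
Proof.
rewrite -(@ler_pXn2r _ 2) ?nnegrE ?enorm_ge0 ?mulr_ge0 ?sqrtr_ge0//.
rewrite lift_sphere_dist /= !exprMn real_normK ?num_real// sqr_sqrtr; last first.
  by rewrite mulr_ge0 ?parallel_ge0.
have := sqr_ge0 (x.2 - y.2); have := sqr_ge0 (parallel x.2 - parallel y.2).
lra.
Qed.

Lemma spherical_dist_theta (R : realType) (t t' p : R) :
  enorm (spherical t p - spherical t' p) <= `|t - t'|.
Proof.
rewrite -(@ler_pXn2r _ 2) ?nnegrE ?enorm_ge0//.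
rewrite enorm_sqr !mxE /=.
have := cos_sinsq t t'; have := norm_sin_le ((t - t') / 2).
have := cos2Dsin2 t; have := cos2Dsin2 t'; have := cos2Dsin2 p.
set c := cos p; set s := sin p; set a := cos t; set b := sin t.
set a' := cos t'; set b' := sin t'; set z := sin _.
move=> ep et' et h e.
have -> : (b * c - b' * c) ^+ 2 + (b * s - b' * s) ^+ 2 + (a - a') ^+ 2 =
  (b ^+ 2 + b' ^+ 2 - 2 * (b * b')) * (c ^+ 2 + s ^+ 2) +
  (a ^+ 2 + a' ^+ 2 - 2 * (a * a')) by ring.
have : z ^+ 2 <= (`|t - t'| / 2) ^+ 2.
  rewrite -[z ^+ 2]real_normK ?num_real// ler_pXn2r ?nnegrE ?divr_ge0//.
  by move: h; rewrite normrM [`|2^-1|]ger0_norm// invr_ge0.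
rewrite ep; nra.
Qed.

Lemma spherical_dist_phi (R : realType) (t p p' : R) :
  enorm (spherical t p - spherical t p') <= `|p - p'|.
Proof.
rewrite -(@ler_pXn2r _ 2) ?nnegrE ?enorm_ge0//.
rewrite enorm_sqr !mxE /=.
have := cos_sinsq p p'; have := norm_sin_le ((p - p') / 2).
have := cos2Dsin2 t; have := cos2Dsin2 p; have := cos2Dsin2 p'.
set c := cos p; set s := sin p; set c' := cos p'; set s' := sin p'.
set a := cos t; set b := sin t; set z := sin _.
move=> ep' ep et h e.
have -> : (b * c - b * c') ^+ 2 + (b * s - b * s') ^+ 2 + (a - a) ^+ 2 =
  b ^+ 2 * ((c ^+ 2 + s ^+ 2) + (c' ^+ 2 + s' ^+ 2) - 2 * (c * c' + s * s')).
  by ring.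
have h2 : z ^+ 2 <= (`|p - p'| / 2) ^+ 2.
  rewrite -[z ^+ 2]real_normK ?num_real// ler_pXn2r ?nnegrE ?divr_ge0//.
  by move: h; rewrite normrM [`|2^-1|]ger0_norm// invr_ge0.
rewrite ep ep' e.
have b1 : b ^+ 2 <= 1 by have := sqr_ge0 a; lra.
have -> : b ^+ 2 * (1 + 1 - 2 * (1 - 2 * z ^+ 2)) = b ^+ 2 * (4 * z ^+ 2) by ring.
apply: (@le_trans _ _ (4 * z ^+ 2)); last by lra.
by rewrite ler_piMl// mulr_ge0// sqr_ge0.
Qed.

(** * Integration over the sphere *)

Lemma holder_half_continuous (R : realType) (g : R -> R) (C : R) :
  (forall x y, (g x - g y) ^+ 2 <= C * `|x - y|) -> continuous g.
Proof.
move=> hg x; apply/cvgrPdist_lt => e e0; near=> y.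
rewrite -(@ltr_pXn2r _ 2) ?nnegrE ?(ltW e0)// real_normK ?num_real//.
apply: (le_lt_trans (hg x y)).
(* [C] is replaced by a positive number, by which one can divide. *)
apply: (@le_lt_trans _ _ ((`|C| + 1) * `|x - y|)).
  by rewrite ler_wpM2r// (le_trans (ler_norm C))// lerDl.
rewrite mulrC -ltr_pdivlMr ?ltr_pwDr//; near: y.
have d0 : 0 < e ^+ 2 / (`|C| + 1) by rewrite divr_gt0 ?exprn_gt0 ?ltr_pwDr.
by exists (e ^+ 2 / (`|C| + 1)).
Unshelve. all: by end_near. Qed.

Lemma integrable_continuous_itv (R : realType) (h : R -> R) (a b : R) :
  continuous h -> lebesgue_measure.-integrable `[a, b] (EFin \o h).
Proof.
move=> ch; apply: continuous_compact_integrable; first exact: segment_compact.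
exact: continuous_subspaceT.
Qed.

(** A lower Darboux sum with density [k]; it serves with [k] = sin for the colatitude and [k] = 1
    for the longitude. *)
Lemma Rintegral_ge_sum (R : realType) (h k : R -> R) (c m : nat -> R) (n : nat) :
  continuous h -> continuous k ->
  (forall j, (j < n)%N -> c j <= c j.+1) ->
  (forall j x, (j < n)%N -> c j <= x <= c j.+1 -> m j * k x <= h x) ->
  \sum_(j < n) m j * \int[@lebesgue_measure R]_(x in `[c j, c j.+1]) k x <=
  \int[@lebesgue_measure R]_(x in `[c 0%N, c n]) h x.
Proof.
move=> ch ck; elim: n => [|n IHn] hc hm.
  by rewrite big_ord0 set_itv1 Rintegral_set1.
rewrite big_ord_recr /=.
have c0n : c 0%N <= c n.
  elim: {IHn hm} n hc => [//|n IHn] hc.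
  by rewrite (le_trans (IHn _) (hc _ _))// => j /leqW/hc.
have := IHn _ _; move=> /(_ (fun j jn => hc j (leqW jn))).
move=> /(_ (fun j x jn => hm j x (leqW jn))) IH.
have -> : \int[@lebesgue_measure R]_(x in `[c 0%N, c n.+1]) h x =
    \int[@lebesgue_measure R]_(x in `[c 0%N, c n]) h x +
    \int[@lebesgue_measure R]_(x in `[c n, c n.+1]) h x.
  apply/eqP; rewrite addrC -subr_eq; apply/eqP.
  rewrite Rintegral_itvB ?bnd_simp ?hc//; last exact: integrable_continuous_itv.
  rewrite Rintegral_itv_obnd_cbnd//.
  apply: integrableS (integrable_continuous_itv (c n) (c n.+1) ch) => //.
  by apply: subset_itvr; rewrite bnd_simp.
apply: lerD => //.
rewrite -RintegralZl//; last exact: integrable_continuous_itv.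
apply: le_Rintegral => //.
- by apply: integrable_continuous_itv => x; apply: cvgM; [exact: cvg_cst|exact: ck].
- exact: integrable_continuous_itv.
- by move=> x /=; rewrite in_itv/= => /hm; exact.
Qed.

Lemma Rintegral_sin (R : realType) (a b : R) : a <= b ->
  \int[@lebesgue_measure R]_(x in `[a, b]) sin x = cos a - cos b.
Proof.
rewrite le_eqVlt => /predU1P[->|ab];
  first by rewrite set_itv1 Rintegral_set1 subrr.
rewrite /Rintegral (@continuous_FTC2 R sin (fun x => - cos x) a b)//=.
- by rewrite opprK addrC.
- exact/continuous_subspaceT/continuous_sin.
- split.
  + by move=> x _; exact: derivableN.
  + by apply: cvg_at_right_filter; apply: cvgN; exact: continuous_cos.
  + by apply: cvg_at_left_filter; apply: cvgN; exact: continuous_cos.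
- by move=> x _; rewrite derive1E deriveN// derive_val opprK.
Qed.

Lemma Rintegral_one (R : realType) (a b : R) : a <= b ->
  \int[@lebesgue_measure R]_(x in `[a, b]) 1 = b - a.
Proof.
rewrite le_eqVlt => /predU1P[->|ab];
  first by rewrite set_itv1 Rintegral_set1 subrr.
rewrite /Rintegral (@continuous_FTC2 R (fun=> 1) id a b)//=.
- by apply: continuous_subspaceT; exact: cst_continuous.
- split=> //.
  + by apply: cvg_at_right_filter; exact: cvg_id.
  + by apply: cvg_at_left_filter; exact: cvg_id.
- by move=> x _; rewrite derive1E derive_id.
Qed.

Lemma spherical_on (R : realType) (t p : R) : sphere (spherical t p).
Proof.
rewrite /sphere /= enormE !mxE /= -[RHS]sqrtr1; congr Num.sqrt.
rewrite !exprMn -mulrDr cos2Dsin2 mulr1 addrC; exact: cos2Dsin2.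
Qed.

(** In these coordinates dx_1 dx_2 = sin theta dtheta dphi / (4 pi), which is why the lifting map
    preserves area. *)
Lemma spherical_lift (R : realType) (t p : R) : 0 <= t <= pi ->
  spherical t p = lift_sphere (p / (2 * pi), (1 - cos t) / 2).
Proof.
move=> t0; rewrite /spherical /lift_sphere /=.
have -> : Num.sqrt ((1 - cos t) / 2 - ((1 - cos t) / 2) ^+ 2) = sin t / 2.
  have -> : (1 - cos t) / 2 - ((1 - cos t) / 2) ^+ 2 = (sin t / 2) ^+ 2.
    by rewrite [RHS]exprMn sin2cos2; field.
  by rewrite sqrtr_sqr ger0_norm// divr_ge0// sin_ge0_pi.
have -> : 2 * pi * (p / (2 * pi)) = p.
  by rewrite mulrC divfK// mulf_neq0// gt_eqF// pi_gt0.
by congr vec3; field.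
Qed.

Lemma continuous_eval_theta (R : realType)
  (H : rkhs (@sphere R) (@distance_kernel R)) (f : H) (p : R) :
  continuous (fun t => rkhs_eval f (spherical t p)).
Proof.
apply: (@holder_half_continuous R _ (`|f| ^+ 2 * 2)) => t t'.
apply: le_trans (rkhs_holder _ (spherical_on _ _) (spherical_on _ _)) _.
by rewrite -[leRHS]mulrA ler_wpM2l ?sqr_ge0// ler_wpM2l// spherical_dist_theta.
Qed.

Lemma continuous_eval_sin (R : realType)
  (H : rkhs (@sphere R) (@distance_kernel R)) (f : H) (p : R) :
  continuous (fun t => rkhs_eval f (spherical t p) * sin t).
Proof.
move=> t; apply: cvgM; first exact: continuous_eval_theta.
exact: continuous_sin.
Qed.

(** The Hölder estimate is uniform in the colatitude and survives integration; the factor 4 is the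
    square of the integral of sin over [0, pi]. *)
Lemma continuous_inner_integral (R : realType)
  (H : rkhs (@sphere R) (@distance_kernel R)) (f : H) :
  continuous (fun p => \int[@lebesgue_measure R]_(t in `[0, pi])
    (rkhs_eval f (spherical t p) * sin t)).
Proof.
apply: (@holder_half_continuous R _ (4 * (`|f| ^+ 2 * 2))) => p p'.
rewrite -RintegralB//; [|exact/integrable_continuous_itv/continuous_eval_sin..].
set k := Num.sqrt (`|f| ^+ 2 * (2 * `|p - p'|)).
have k0 : 0 <= `|f| ^+ 2 * (2 * `|p - p'|) by rewrite !mulr_ge0// sqr_ge0.
have ci : continuous (fun t => rkhs_eval f (spherical t p) * sin t -
    rkhs_eval f (spherical t p') * sin t).
  by move=> t; apply: cvgB; exact: continuous_eval_sin.
have le2k : `|\int[@lebesgue_measure R]_(t in `[0, pi])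
    (rkhs_eval f (spherical t p) * sin t -
     rkhs_eval f (spherical t p') * sin t)| <= 2 * k.
  apply: (le_trans (le_normr_Rintegral _ _)) => //.
    exact: integrable_continuous_itv.
  apply: (@le_trans _ _ (\int[@lebesgue_measure R]_(t in `[0, pi]) (k * sin t))).
    apply: le_Rintegral => //=.
    - apply: (@integrable_continuous_itv _ (fun t => `|_|)) => t.
      by apply: cvg_norm; exact: ci.
    - apply: integrable_continuous_itv => t.
      by apply: cvgM; [exact: cvg_cst|exact: continuous_sin].
    - move=> t; rewrite /= in_itv/= => t0.
      rewrite -mulrBl normrM [`|sin t|]ger0_norm ?sin_ge0_pi//.
      rewrite ler_wpM2r ?sin_ge0_pi//.
      rewrite -(@ler_pXn2r _ 2) ?nnegrE ?sqrtr_ge0// sqr_sqrtr//.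
      rewrite real_normK ?num_real//.
      apply: le_trans (rkhs_holder _ (spherical_on _ _) (spherical_on _ _)) _.
      by rewrite ler_wpM2l ?sqr_ge0// ler_wpM2l// spherical_dist_phi.
  rewrite RintegralZl//; last exact/integrable_continuous_itv/continuous_sin.
  by rewrite Rintegral_sin ?pi_ge0// cos0 cospi opprK mulrC.
rewrite -[X in X <= _]real_normK ?num_real//.
have -> : 4 * (`|f| ^+ 2 * 2) * `|p - p'| = (2 * k) ^+ 2.
  by rewrite exprMn sqr_sqrtr//; ring.
by rewrite ler_pXn2r// nnegrE ?mulr_ge0// sqrtr_ge0.
Qed.

(** [th] and [ph] are the grid lines in spherical coordinates. Each row has cos (th j) - cos (th
    j.+1) = 2 / B and each column has width 2 pi / A, so after division by 4 pi every cell has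
    weight 1 / (A B). *)
Lemma sphere_integral_ge (R : realType)
  (H : rkhs (@sphere R) (@distance_kernel R)) (f : H) (A B : nat)
  (m : nat -> nat -> R) : (0 < A)%N -> (0 < B)%N ->
  (forall i j x, (i < A)%N -> (j < B)%N ->
    i%:R / A%:R <= x.1 <= i.+1%:R / A%:R ->
    j%:R / B%:R <= x.2 <= j.+1%:R / B%:R ->
    m i j <= rkhs_eval f (lift_sphere x)) ->
  (A * B)%:R^-1 * (\sum_(i < A) \sum_(j < B) m i j) <=
  sphere_integral (rkhs_eval f).
Proof.
move=> A0 B0 hm; rewrite /sphere_integral.
have pi0 := pi_gt0 R.
have A0' : 0 < A%:R :> R by rewrite ltr0n.
have B0' : 0 < B%:R :> R by rewrite ltr0n.
pose th j : R := acos (1 - 2 * (j%:R / B%:R)).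
pose ph i : R := 2 * pi * (i%:R / A%:R).
have jB j : (j <= B)%N -> -1 <= 1 - 2 * (j%:R / B%:R : R) <= 1.
  move=> jB; have : j%:R / B%:R <= 1 :> R by rewrite ler_pdivrMr// mul1r ler_nat.
  have : 0 <= j%:R / B%:R :> R by rewrite divr_ge0.
  by move=> ? ?; apply/andP; split; lra.
have thB j : (j <= B)%N -> 0 <= th j <= pi.
  by move=> /jB h; rewrite acos_ge0// acos_lepi.
have cth j : (j <= B)%N -> cos (th j) = 1 - 2 * (j%:R / B%:R).
  by move=> /jB h; rewrite acosK// in_itv.
have lecos (x y : R) : 0 <= x <= pi -> 0 <= y <= pi -> (cos x <= cos y) = (y <= x).
  by move=> hx hy; rewrite !leNgt ltr_cos// in_itv.
have th0 : th 0%N = 0 by rewrite /th mul0r mulr0 subr0 acos1.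
have thpi : th B = pi.
  by rewrite /th divff ?gt_eqF// mulr1 (_ : 1 - 2 = -1) ?acosN1//; ring.
have hth j : (j < B)%N -> th j <= th j.+1.
  move=> jB'; rewrite -lecos ?thB// ?(ltnW jB')// !cth// ?(ltnW jB')//.
  by rewrite lerD2l lerN2 ler_wpM2l// ler_wpM2r ?invr_ge0 ?(ltW B0')// ler_nat.
have inner i p : (i < A)%N -> ph i <= p <= ph i.+1 ->
    2 / B%:R * \sum_(j < B) m i j <=
    \int[@lebesgue_measure R]_(t in `[0, pi])
      (rkhs_eval f (spherical t p) * sin t).
  move=> iA hp.
  have := @Rintegral_ge_sum R (fun t => rkhs_eval f (spherical t p) * sin t) sin
    th (m i) B (@continuous_eval_sin R H f p) (@continuous_sin R) hth.
  rewrite th0 thpi => IH; apply: le_trans (IH _); last first.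
    move=> j t jB' /andP[t1 t2].
    have t0 : 0 <= t <= pi.
      apply/andP; split.
        by apply: le_trans t1; have /andP[] := thB j (ltnW jB').
      by apply: le_trans t2 _; have /andP[] := thB _ jB'.
    rewrite ler_wpM2r ?sin_ge0_pi// spherical_lift//; apply: hm => //=.
      move: hp; rewrite /ph => /andP[p1 p2].
      rewrite ler_pdivlMr ?ler_pdivrMr ?mulr_gt0//.
      by rewrite !(mulrC _ (2 * pi)) p1.
    have h1 : cos t <= cos (th j) by rewrite lecos// thB// ltnW.
    have h2 : cos (th j.+1) <= cos t by rewrite lecos// thB.
    by move: h1 h2; rewrite !cth ?(ltnW jB')//; lra.
  rewrite mulr_sumr le_eqVlt; apply/orP; left; apply/eqP/eq_bigr => j _.
  rewrite Rintegral_sin ?hth// !cth//; last exact: ltnW.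
  by rewrite -natr1; field; rewrite gt_eqF.
have := @Rintegral_ge_sum R (fun p => \int[@lebesgue_measure R]_(t in `[0, pi])
      (rkhs_eval f (spherical t p) * sin t)) (fun=> 1) ph
  (fun i => 2 / B%:R * \sum_(j < B) m i j) A
  (@continuous_inner_integral R H f) (@cst_continuous _ _ _).
have -> : ph 0%N = 0 by rewrite /ph mul0r mulr0.
have -> : ph A = 2 * pi by rewrite /ph divff ?gt_eqF// mulr1.
have phS i : ph i <= ph i.+1.
  rewrite /ph ler_wpM2l ?mulr_ge0 ?(ltW pi0)//.
  by rewrite ler_wpM2r ?invr_ge0 ?(ltW A0')// ler_nat.
move=> /(_ _ _) IH.
have pi4 : 0 < 4 * pi :> R by rewrite mulr_gt0.
rewrite [leRHS]mulrC ler_pdivlMr//.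
apply: le_trans (IH _ _); last first.
- by move=> i x iA hx; rewrite mulr1 inner.
- by move=> i _; exact: phS.
rewrite le_eqVlt; apply/orP; left; apply/eqP.
rewrite mulrAC mulr_sumr; apply: eq_bigr => i _.
rewrite Rintegral_one ?phS// /ph natrM -natr1.
by field; rewrite !gt_eqF.
Qed.

(** Closed on all sides, unlike the elementary intervals of a net, to match the closed segments of
    the Darboux sums. *)
Definition cell (R : realType) (A B i j : nat) : set (R * R) :=
  [set x | i%:R / A%:R <= x.1 <= i.+1%:R / A%:R /\
           j%:R / B%:R <= x.2 <= j.+1%:R / B%:R].

Lemma cell_itv (R : realType) (A B i j : nat) (x : R * R) :
  (j < B)%N -> cell A B i j x -> 0 <= x.2 <= 1.
Proof.
move=> jB [_ /andP[h1 h2]].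
have B0 : 0 < B%:R :> R by rewrite ltr0n (leq_trans _ jB).
apply/andP; split; first by apply: le_trans h1; rewrite divr_ge0.
by apply: (le_trans h2); rewrite ler_pdivrMr// mul1r ler_nat.
Qed.

Lemma rkhs_evalN (R : realType) (T : Type) (D : set T) (K : T -> T -> R)
  (H : rkhs D K) (f : H) (x : T) : D x -> rkhs_eval (- f) x = - rkhs_eval f x.
Proof.
move=> Dx; rewrite !rkhs_reproducing//.
by rewrite linearNl.
Qed.

Lemma sphere_integralN (R : realType)
  (H : rkhs (@sphere R) (@distance_kernel R)) (f : H) :
  sphere_integral (rkhs_eval (- f)) = - sphere_integral (rkhs_eval f).
Proof.
rewrite /sphere_integral -mulrN; congr (_ * _).
rewrite -mulN1r -RintegralZl//; last first.
  exact/integrable_continuous_itv/continuous_inner_integral.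
apply: eq_Rintegral => p _; rewrite -RintegralZl//; last first.
  exact/integrable_continuous_itv/continuous_eval_sin.
apply: eq_Rintegral => t _.
by rewrite rkhs_evalN ?mulNr ?mul1r//; exact: spherical_on.
Qed.

(** The integral is at least the mean of the infima of f over the cells. The bound [S] must serve
    every [w], because the near-minimizers depend on f and on the tolerance. *)
Lemma equal_weight_error_le (R : realType)
  (H : rkhs (@sphere R) (@distance_kernel R)) (f : H) (A B : nat)
  (z : 'I_A * 'I_B -> R * R) (S : R) :
  (0 < A)%N -> (0 < B)%N -> `|f| <= 1 ->
  (forall k : 'I_A * 'I_B, cell A B k.1 k.2 (z k)) ->
  (forall w, (forall k : 'I_A * 'I_B, cell A B k.1 k.2 (w k)) ->
    \sum_k \sum_l `|mixdiff (lift_sphere (z k)) (lift_sphere (w k))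
      (lift_sphere (z l)) (lift_sphere (w l))| <= S) ->
  (A * B)%:R^-1 * \sum_k rkhs_eval f (lift_sphere (z k)) -
  sphere_integral (rkhs_eval f) <= Num.sqrt S / (A * B)%:R.
Proof.
move=> A0 B0 f1 hz hS.
have N0 : 0 < (A * B)%:R :> R by rewrite ltr0n muln_gt0 A0.
pose V i j := [set rkhs_eval f (lift_sphere x) | x in cell A B i j].
have hasinf i j : (i < A)%N -> (j < B)%N -> has_inf (V i j).
  move=> iA jB; split.
    by exists (rkhs_eval f (lift_sphere (z (Ordinal iA, Ordinal jB))));
      exists (z (Ordinal iA, Ordinal jB)) => //; exact: hz (Ordinal iA, Ordinal jB).
  exists (- (`|f| * Num.sqrt (8 / 3))) => _ [x cx <-].
  have := rkhs_bounded f (lift_sphere_on (cell_itv jB cx)).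
  by rewrite ler_norml => /andP[].
have lower : (A * B)%:R^-1 * \sum_(k : 'I_A * 'I_B) inf (V k.1 k.2) <=
    sphere_integral (rkhs_eval f).
  rewrite -(pair_bigA _ (fun (i : 'I_A) (j : 'I_B) => inf (V i j))) /=.
  apply: (sphere_integral_ge (m := fun i j => inf (V i j))) => // i j x iA jB h1 h2.
  by apply: ge_inf; [case: (hasinf i j iA jB)|exists x].
apply/ler_addgt0Pr => e e0.
(* The tolerance [e] in each of the A B cells costs [e] in total after averaging. *)
have /choice [w hw] : forall k : 'I_A * 'I_B, exists x, cell A B k.1 k.2 x /\
    rkhs_eval f (lift_sphere x) <= inf (V k.1 k.2) + e.
  move=> k; have [v [x cx <-] /ltW hx] :=
    inf_adherent e0 (hasinf _ _ (ltn_ord k.1) (ltn_ord k.2)).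
  by exists x.
have hwc (k : 'I_A * 'I_B) : cell A B k.1 k.2 (w k) by case: (hw k).
have on (k : 'I_A * 'I_B) x : cell A B k.1 k.2 x -> sphere (lift_sphere x).
  by move=> /(cell_itv (ltn_ord k.2)); exact: lift_sphere_on.
set Z := fun k => lift_sphere (z k); set W := fun k => lift_sphere (w k).
have sumle : \sum_k (rkhs_eval f (Z k) - rkhs_eval f (W k)) <= Num.sqrt S.
  apply: (le_trans (ler_norm _)); rewrite -sqrtr_sqr ler_wsqrtr//.
  apply: (@le_trans _ _ (1 * S)); last by rewrite mul1r.
  apply: le_trans (rkhs_sum_le _ _ _) _.
  - by move=> k; exact: on (hz k).
  - by move=> k; exact: on (hwc k).
  - apply: ler_pM; first exact: sqr_ge0.
    + by do 2!(apply: sumr_ge0 => ? _).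
    + by rewrite expr_le1.
    + exact: hS.
have infle : \sum_k rkhs_eval f (W k) <=
    \sum_(k : 'I_A * 'I_B) inf (V k.1 k.2) + (A * B)%:R * e.
  rewrite -[A in (A * B)%N]card_ord -[B in (_ * B)%N]card_ord -card_prod.
  rewrite mulr_natl -sumr_const -big_split /=.
  by apply: ler_sum => k _; case: (hw k).
rewrite lerBlDr; apply: le_trans (lerD (lexx _) lower).
rewrite -(ler_pM2l N0) !mulrDr !mulrA mulfV ?gt_eqF// !mul1r.
rewrite (mulrC _ (Num.sqrt S)) mulfK ?gt_eqF//.
by move: sumle infle; rewrite sumrB; lra.
Qed.

(** * Sums over rows and columns *)

Lemma sum_inv_sqrt_le (R : realType) (n : nat) :
  \sum_(j < n) (Num.sqrt j.+1%:R)^-1 <= 2 * Num.sqrt n%:R :> R.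
Proof.
elim: n => [|n IHn]; first by rewrite big_ord0 mulr_ge0 ?sqrtr_ge0.
rewrite big_ord_recr /=; apply: le_trans (lerD IHn (lexx _)) _.
have ha : Num.sqrt n%:R ^+ 2 = n%:R :> R by rewrite sqr_sqrtr.
have hc : Num.sqrt n.+1%:R ^+ 2 = n%:R + 1 :> R by rewrite sqr_sqrtr// -natr1.
have c0 : 0 < Num.sqrt n.+1%:R :> R by rewrite sqrtr_gt0.
move: ha hc c0; set a := Num.sqrt _; set c := Num.sqrt _ => ha hc c0.
rewrite -(ler_pM2r c0) mulrDl mulVf ?gt_eqF//.
(* With 1 = c^2 - a^2 the induction step becomes 2 a c <= a^2 + c^2. *)
have := sqr_ge0 (a - c); lra.
Qed.

(** Fourth roots occur because [rowq] below is a square root and enters with exponent 3/2. *)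
Definition root4 (R : realType) (x : R) : R := Num.sqrt (Num.sqrt x).

Lemma root4_ge0 (R : realType) (x : R) : 0 <= root4 x.
Proof. exact: sqrtr_ge0. Qed.

Lemma root4_sqr (R : realType) (x : R) : root4 x ^+ 2 = Num.sqrt x.
Proof. by rewrite sqr_sqrtr// sqrtr_ge0. Qed.

Lemma root4_gt0 (R : realType) (x : R) : 0 < x -> 0 < root4 x.
Proof. by move=> x0; rewrite !sqrtr_gt0. Qed.

Lemma sum_inv_root4_le (R : realType) (n : nat) :
  \sum_(j < n) (root4 j.+1%:R)^-1 ^+ 3 <= 4 * root4 n%:R :> R.
Proof.
elim: n => [|n IHn]; first by rewrite big_ord0 mulr_ge0 ?sqrtr_ge0.
rewrite big_ord_recr /=; apply: le_trans (lerD IHn (lexx _)) _.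
have ha : root4 n%:R ^+ 4 = n%:R :> R.
  by rewrite (exprM _ 2 2) root4_sqr sqr_sqrtr.
have hc : root4 n.+1%:R ^+ 4 = n%:R + 1 :> R.
  by rewrite (exprM _ 2 2) root4_sqr sqr_sqrtr// -natr1.
have c0 : 0 < root4 n.+1%:R :> R by rewrite root4_gt0.
have a0 := root4_ge0 (n%:R : R).
move: ha hc c0 a0; set a := root4 _; set c := root4 _ => ha hc c0 a0.
rewrite -(ler_pM2r (exprn_gt0 3 c0)) mulrDl -exprMn mulVf ?gt_eqF// expr1n.
(* With 1 = c^4 - a^4 the induction step becomes 3 c^4 - 4 a c^3 + a^4 >= 0, factored here. *)
have : 0 <= (c - a) ^+ 2 * (3 * c ^+ 2 + 2 * (a * c) + a ^+ 2).
  by rewrite mulr_ge0 ?sqr_ge0// !addr_ge0 ?mulr_ge0 ?sqr_ge0// ltW.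
lra.
Qed.

Lemma harmonic_le_ln (R : realType) (n : nat) : (0 < n)%N ->
  \sum_(j < n) j.+1%:R^-1 <= 1 + ln n%:R :> R.
Proof.
case: n => // n _; elim: n => [|n IHn].
  by rewrite big_ord1 ln1 addr0 invr1.
rewrite big_ord_recr /=; apply: le_trans (lerD IHn (lexx _)) _.
(* The new term 1 / (n + 2) is at most - ln (1 - 1 / (n + 2)), the increment of the logarithm. *)
rewrite -addrA lerD2l -lerBrDl -lerN2 opprB -ln_div ?posrE ?ltr0n//.
have -> : n.+1%:R / n.+2%:R = 1 + - n.+2%:R^-1 :> R.
  by rewrite -[n.+1%:R](addrK 1) natr1 mulrBl divff ?pnatr_eq0// div1r.
by apply: le_ln1Dx; rewrite ltrN2 invf_lt1 ?ltr1n// ltr0n.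
Qed.

(** The distance of i and k: at least one of the truncated differences is 0. *)
Definition gap (i k : nat) : nat := (i - k + (k - i))%N.

(** Each distance is attained at most twice, once on either side of [i]. *)
Lemma sum_gap_le (R : realType) (g : nat -> R) (A i : nat) :
  (forall d, 0 <= g d) -> (i < A)%N ->
  \sum_(k < A) g (gap i k) <= 2 * \sum_(d < A) g d.
Proof.
move=> g0 iA; rewrite -!(big_mkord xpredT (fun k => g (_ k))).
rewrite -!(big_mkord xpredT).
have sub n : (n <= A)%N -> \sum_(0 <= d < n) g d <= \sum_(0 <= d < A) g d.
  by move=> nA; rewrite [leRHS](big_cat_nat (n := n))//= lerDl sumr_ge0.
rewrite (big_cat_nat (n := i.+1))//= mulr_natl mulr2n; apply: lerD.
  rewrite big_nat_rev /= add0n; apply: le_trans (sub _ iA).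
  rewrite le_eqVlt; apply/orP; left; apply/eqP.
  by apply: eq_big_nat => d hd; congr g; rewrite /gap; lia.
rewrite -{1}[i.+1]add0n big_addn.
apply: (@le_trans _ _ (\sum_(0 <= d < A - i.+1) g d.+1)).
  rewrite le_eqVlt; apply/orP; left; apply/eqP.
  by apply: eq_big_nat => d hd; congr g; rewrite /gap; lia.
apply: le_trans (sub (A - i.+1).+1 _); last by lia.
by rewrite big_nat_recl// lerDr.
Qed.

(* For points with x_2 in [j / B, (j + 1) / B], rowq B j / B is comparable to
   the radius of the parallel, and 1 / rowq B j to the diameter of the lifted
   cell; unlike the radius, it does not vanish in the rows at the poles. *)
Definition rowq (R : realType) (B j : nat) : R :=
  Num.sqrt (j.+1 * (B - j))%:R.

Lemma rowq_gt0 (R : realType) (B j : nat) : (j < B)%N -> 0 < rowq R B j.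
Proof. by move=> jB; rewrite sqrtr_gt0 ltr0n muln_gt0 subn_gt0. Qed.

Lemma rowq_le (R : realType) (B j : nat) : (j < B)%N -> rowq R B j <= B%:R.
Proof.
move=> jB; rewrite -(@ler_pXn2r _ 2) ?nnegrE ?sqrtr_ge0// sqr_sqrtr//.
by rewrite -natrX ler_nat -mulnn leq_mul// leq_subr.
Qed.

(** Partial fractions, exact with B + 1 in place of B. The two poles are thereby separated, and sums
    over rows reduce to power sums. *)
Lemma inv_rowq_sqr (R : realType) (B j : nat) : (j < B)%N ->
  (rowq R B j)^-1 ^+ 2 <= B%:R^-1 * (j.+1%:R^-1 + (B - j)%:R^-1).
Proof.
move=> jB; have B0 : (0 < B)%N by apply: leq_trans jB.
have d0 : (0 < B - j)%N by rewrite subn_gt0.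
rewrite exprVn sqr_sqrtr// natrM natrB ?(ltnW jB)// -natr1.
have b0 : 0 < B%:R :> R by rewrite ltr0n.
have a0 : 0 < j%:R + 1 :> R by rewrite natr1 ltr0n.
have c0 : 0 < B%:R - j%:R :> R by rewrite subr_gt0 ltr_nat.
have -> : (j%:R + 1)^-1 + (B%:R - j%:R)^-1 =
    (B%:R + 1) * ((j%:R + 1) * (B%:R - j%:R))^-1 :> R.
  by field; rewrite !gt_eqF.
rewrite mulrA ler_peMl ?invr_ge0 ?mulr_ge0 ?(ltW a0) ?(ltW c0)//.
by rewrite mulrDr mulVf ?gt_eqF// lerDl mulr1 invr_ge0 ltW.
Qed.

Lemma sqrtr_add_le (R : realType) (x y : R) : 0 <= x -> 0 <= y ->
  Num.sqrt (x + y) <= Num.sqrt x + Num.sqrt y.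
Proof.
move=> x0 y0; rewrite -(@ler_pXn2r _ 2) ?nnegrE ?addr_ge0 ?sqrtr_ge0//.
rewrite sqrrD !sqr_sqrtr ?addr_ge0//.
have : 0 <= Num.sqrt x * Num.sqrt y by rewrite mulr_ge0 ?sqrtr_ge0.
lra.
Qed.

Lemma inv_rowq_le (R : realType) (B j : nat) : (j < B)%N ->
  (rowq R B j)^-1 <= (Num.sqrt B%:R)^-1 *
    ((Num.sqrt j.+1%:R)^-1 + (Num.sqrt (B - j)%:R)^-1).
Proof.
move=> jB; have q0 := rowq_gt0 R jB.
rewrite -[leLHS]ger0_norm ?invr_ge0 ?(ltW q0)// -sqrtr_sqr.
apply: le_trans (ler_wsqrtr (inv_rowq_sqr R jB)) _.
rewrite sqrtrM ?invr_ge0// sqrtrV// ler_wpM2l ?invr_ge0 ?sqrtr_ge0//.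
by apply: le_trans (sqrtr_add_le _ _) _; rewrite ?invr_ge0// !sqrtrV.
Qed.

Lemma inv_sqrt_rowq_le (R : realType) (B j : nat) : (j < B)%N ->
  (Num.sqrt (rowq R B j))^-1 <= (root4 B%:R)^-1 *
    ((root4 j.+1%:R)^-1 + (root4 (B - j)%:R)^-1).
Proof.
move=> jB; have q0 := rowq_gt0 R jB.
rewrite -sqrtrV ?(ltW q0)//.
apply: le_trans (ler_wsqrtr (inv_rowq_le R jB)) _.
rewrite sqrtrM ?invr_ge0 ?sqrtr_ge0// sqrtrV ?sqrtr_ge0//.
rewrite ler_wpM2l ?invr_ge0 ?sqrtr_ge0//.
by apply: le_trans (sqrtr_add_le _ _) _;
  rewrite ?invr_ge0 ?sqrtr_ge0// !sqrtrV ?sqrtr_ge0.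
Qed.

Lemma sum_rev_ord (R : realType) (B : nat) (h : nat -> R) :
  \sum_(j < B) h (B - j)%N = \sum_(j < B) h j.+1.
Proof.
rewrite (reindex_inj rev_ord_inj) /=; apply: eq_bigr => j _.
by congr h; have := ltn_ord j; lia.
Qed.

Lemma sum_inv_rowq_le (R : realType) (B : nat) : (0 < B)%N ->
  \sum_(j < B) (rowq R B j)^-1 <= 4.
Proof.
move=> B0; have b0 : 0 < Num.sqrt B%:R :> R by rewrite sqrtr_gt0 ltr0n.
apply: (@le_trans _ _ (\sum_(j < B) (Num.sqrt B%:R)^-1 *
    ((Num.sqrt j.+1%:R)^-1 + (Num.sqrt (B - j)%:R)^-1))).
  by apply: ler_sum => j _; exact: inv_rowq_le.
rewrite -mulr_sumr mulrC ler_pdivrMr// big_split /=.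
rewrite (sum_rev_ord B (fun k => (Num.sqrt k%:R)^-1)).
have := sum_inv_sqrt_le R B; lra.
Qed.

(** The decay in B matters: its square cancels the factor B in the last term of
    [mixdiff_cell_le]. *)
Lemma sum_inv_rowq32_le (R : realType) (B : nat) : (0 < B)%N ->
  \sum_(j < B) (rowq R B j * Num.sqrt (rowq R B j))^-1 <= 16 / Num.sqrt B%:R.
Proof.
move=> B0; have b0 : 0 < root4 B%:R :> R by rewrite root4_gt0 ?ltr0n.
set c := (root4 B%:R)^-1 : R.
have c0 : 0 < c by rewrite invr_gt0.
apply: (@le_trans _ _ (\sum_(j < B) 2 * c ^+ 3 *
    ((root4 j.+1%:R)^-1 ^+ 3 + (root4 (B - j)%:R)^-1 ^+ 3))).
  apply: ler_sum => j _; have q0 := rowq_gt0 R (ltn_ord j).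
  have := inv_rowq_le R (ltn_ord j); have := inv_sqrt_rowq_le R (ltn_ord j).
  rewrite invfM -!root4_sqr -!exprVn -/c.
  have x0 : 0 <= (root4 j.+1%:R)^-1 :> R by rewrite invr_ge0 root4_ge0.
  have y0 : 0 <= (root4 (B - j)%:R)^-1 :> R by rewrite invr_ge0 root4_ge0.
  move: x0 y0; set x := (root4 j.+1%:R)^-1; set y := (root4 (B - j)%:R)^-1.
  move=> x0 y0 h1 h2.
  apply: (@le_trans _ _ (c ^+ 2 * (x ^+ 2 + y ^+ 2) * (c * (x + y)))).
    by apply: ler_pM => //; rewrite ?exprn_ge0 ?invr_ge0 ?root4_ge0 ?(ltW q0).
  have -> : c ^+ 2 * (x ^+ 2 + y ^+ 2) * (c * (x + y)) =
    c ^+ 3 * ((x ^+ 2 + y ^+ 2) * (x + y)) by ring.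
  rewrite (mulrC 2) -[leRHS]mulrA ler_wpM2l ?exprn_ge0 ?(ltW c0)//.
  (* This is the difference of 2 (x^3 + y^3) and (x^2 + y^2) (x + y). *)
  have : 0 <= (x + y) * (x - y) ^+ 2 by rewrite mulr_ge0 ?sqr_ge0 ?addr_ge0.
  lra.
rewrite -mulr_sumr big_split /=.
rewrite (sum_rev_ord B (fun k => (root4 k%:R)^-1 ^+ 3)).
have := sum_inv_root4_le R B; set T := \sum_(j < B) _ => hT.
apply: (@le_trans _ _ (2 * c ^+ 3 * (4 * c^-1 + 4 * c^-1))).
  rewrite ler_wpM2l ?mulr_ge0 ?exprn_ge0 ?(ltW c0)//.
  by rewrite /c invrK lerD.
rewrite -root4_sqr -exprVn -/c le_eqVlt; apply/orP; left; apply/eqP.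
by field; rewrite gt_eqF.
Qed.

(** * Mixed differences between cells *)

Definition polar (B j : nat) : bool := (j == 0%N) || (j.+1 == B).

Lemma rowq_sqr (R : realType) (B j : nat) : (j < B)%N ->
  rowq R B j ^+ 2 = (j%:R + 1) * (B%:R - j%:R).
Proof. by move=> jB; rewrite sqr_sqrtr// natrM natrB ?(ltnW jB)// natr1. Qed.

(** Off the polar rows, 2 j >= j + 1 and 2 (B - j - 1) >= B - j; in a polar row the radius can
    vanish. *)
Lemma parallel_ge (R : realType) (B j : nat) (t : R) : (j < B)%N ->
  ~~ polar B j -> j%:R / B%:R <= t <= j.+1%:R / B%:R ->
  rowq R B j / B%:R <= parallel t.
Proof.
move=> jB; rewrite negb_or => /andP[j0 j1] /andP[t1 t2].
have b0 : 0 < B%:R :> R by rewrite ltr0n (leq_trans _ jB).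
have hj : 1 <= j%:R :> R by rewrite ler1n lt0n.
have hB : j%:R + 2 <= B%:R :> R.
  by rewrite -natrD ler_nat; move: j1 jB; lia.
have t01 : 0 <= t <= 1.
  apply/andP; split; first by apply: le_trans t1; rewrite divr_ge0// ltW.
  by apply: (le_trans t2); rewrite ler_pdivrMr// mul1r ler_nat.
rewrite -(@ler_pXn2r _ 2) ?nnegrE ?parallel_ge0 ?divr_ge0 ?sqrtr_ge0 ?(ltW b0)//.
rewrite parallel_sqr// expr_div_n rowq_sqr// ler_pdivrMr ?exprn_gt0//.
move: t1 t2; rewrite ler_pdivrMr// ler_pdivlMr// -natr1 => t1 t2.
have -> : 4 * (t * (1 - t)) * B%:R ^+ 2 =
  (2 * (t * B%:R)) * (2 * (B%:R - t * B%:R)).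
  by ring.
by apply: ler_pM; lra.
Qed.

(** The squares of the radii differ by at most 4 / B. Off the polar rows one divides by the sum of
    the radii, at least 2 q / B with q = [rowq R B j]. In a polar row the difference is at most the
    sum, so its square is at most 4 / B, and q^2 = B. *)
Lemma parallel_dist_le (R : realType) (B j : nat) (t s : R) : (j < B)%N ->
  j%:R / B%:R <= t <= j.+1%:R / B%:R -> j%:R / B%:R <= s <= j.+1%:R / B%:R ->
  `|parallel t - parallel s| <= 2 / rowq R B j.
Proof.
move=> jB ht hs; have q0 := rowq_gt0 R jB.
have b0 : 0 < B%:R :> R by rewrite ltr0n (leq_trans _ jB).
have itv (r : R) : j%:R / B%:R <= r <= j.+1%:R / B%:R -> 0 <= r <= 1.
  move=> /andP[h1 h2]; apply/andP; split.
    by apply: le_trans h1; rewrite divr_ge0// ltW.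
  by apply: (le_trans h2); rewrite ler_pdivrMr// mul1r ler_nat.
have t01 := itv _ ht; have s01 := itv _ hs.
have ts : `|t - s| <= B%:R^-1.
  move: ht hs; rewrite ler_norml -natr1 mulrDl div1r.
  by move=> /andP[? ?] /andP[? ?]; apply/andP; split; lra.
have P0 := parallel_ge0 t; have Q0 := parallel_ge0 s.
have prod : `|parallel t - parallel s| * (parallel t + parallel s) <= 4 / B%:R.
  rewrite -[X in _ * X]ger0_norm ?addr_ge0// -normrM -subr_sqr !parallel_sqr//.
  have -> : 4 * (t * (1 - t)) - 4 * (s * (1 - s)) = 4 * ((t - s) * (1 - t - s)).
    by ring.
  rewrite normrM [`|4|]ger0_norm// ler_pM2l// normrM -[leRHS]mulr1.
  by apply: ler_pM => //; rewrite ler_norml; apply/andP; split; lra.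
rewrite ler_pdivlMr//.
have [pol|pol] := boolP (polar B j); last first.
  have := parallel_ge jB pol ht; have := parallel_ge jB pol hs.
  rewrite !ler_pdivrMr// => h1 h2.
  move: prod; rewrite ler_pdivlMr// => prod.
  have := ler_wpM2l (normr_ge0 (parallel t - parallel s)) (lerD h1 h2).
  lra.
have q2 : rowq R B j ^+ 2 = B%:R.
  rewrite rowq_sqr//; case/orP: pol => [/eqP->|/eqP <-].
    by rewrite add0r subr0 mul1r.
  by rewrite -natr1; ring.
rewrite -(@ler_pXn2r _ 2) ?nnegrE ?mulr_ge0 ?(ltW q0)//.
rewrite exprMn q2 -ler_pdivlMr//.
have -> : 2 ^+ 2 = 4 :> R by ring.
apply: le_trans prod; rewrite expr2 ler_wpM2l//.
by apply: (le_trans (ler_normB _ _)); rewrite !ger0_norm.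
Qed.

(** The constant is 2 from the radii, 8 b from the longitudes as 1 / A <= b / B, and 2 from the
    heights; moreover 1 / B <= 1 / q. *)
Lemma cell_diam_le (R : realType) (b A B i j : nat) (x y : R * R) :
  (0 < A)%N -> (B <= b * A)%N -> (j < B)%N ->
  cell A B i j x -> cell A B i j y ->
  enorm (lift_sphere x - lift_sphere y) <= (4 + 8 * b%:R) / rowq R B j.
Proof.
move=> A0 BA jB cx cy; have q0 := rowq_gt0 R jB.
have b0 : 0 < B%:R :> R by rewrite ltr0n (leq_trans _ jB).
have a0 : 0 < A%:R :> R by rewrite ltr0n.
apply: le_trans (lift_sphere_dist_le (cell_itv jB cx) (cell_itv jB cy)) _.
case: cx cy => [x1 x2] [y1 y2].
have h3 := parallel_dist_le jB x2 y2.
have qB : B%:R^-1 <= (rowq R B j)^-1 by rewrite lef_pV2 ?posrE// rowq_le.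
have h1 : `|x.1 - y.1| <= b%:R / rowq R B j.
  apply: (@le_trans _ _ A%:R^-1).
    move: x1 y1; rewrite ler_norml -natr1 mulrDl div1r.
    by move=> /andP[? ?] /andP[? ?]; apply/andP; split; lra.
  apply: (@le_trans _ _ (b%:R / B%:R)); last by rewrite ler_wpM2l.
  by rewrite ler_pdivlMr// mulrC ler_pdivrMr// -natrM ler_nat.
have h2 : `|x.2 - y.2| <= (rowq R B j)^-1.
  apply: le_trans qB.
  move: x2 y2; rewrite ler_norml -natr1 mulrDl div1r.
  by move=> /andP[? ?] /andP[? ?]; apply/andP; split; lra.
by rewrite mulrDl; lra.
Qed.

(** Adjacency is cyclic: the first and the last column, at distance A - 1, meet along a meridian. *)
Definition near_col (A d : nat) : bool := (d <= 1)%N || (A.-1 <= d)%N.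

(* Meaningful only for far columns, 1 < d < A - 1; otherwise 0^-1 = 0 and the
   truncated subtraction give some nonnegative value. *)
Definition gap_weight (R : realType) (A d : nat) : R :=
  d.-1%:R^-1 + (A.-1 - d)%:R^-1.

Lemma gap_weight_ge0 (R : realType) (A d : nat) : 0 <= gap_weight R A d.
Proof. by rewrite addr_ge0 ?invr_ge0. Qed.

Lemma natr_gap (R : realType) (i k : nat) : (gap i k)%:R = `|i%:R - k%:R| :> R.
Proof.
rewrite /gap; have [ik|/ltnW ki] := leqP i k.
  rewrite (eqP ik) add0n natrB// distrC ger0_norm// subr_ge0 ler_nat//.
by rewrite (eqP ki) addn0 natrB// ger0_norm// subr_ge0 ler_nat.
Qed.

(** For columns at distance d one has d - 1 <= A u <= d + 1, and for far columns both u and 1 - u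
    are then bounded away from 0, as [inv_sin_pi_le] requires. *)
Lemma cell_sin_le (R : realType) (A B i j i' j' : nat) (x y : R * R) :
  ~~ near_col A (gap i i') -> cell A B i j x -> cell A B i' j' y ->
  0 < `|sin (pi * (x.1 - y.1))| /\
  `|sin (pi * (x.1 - y.1))|^-1 <= A%:R * gap_weight R A (gap i i').
Proof.
rewrite negb_or -!ltnNge => /andP[d1 d2] [/andP[x1 x2] _] [/andP[y1 y2] _].
have a0 : 0 < A%:R :> R by rewrite ltr0n; move: d2; lia.
set d := gap i i' in d1 d2 *.
have dm : (d.-1)%:R = d%:R - 1 :> R by rewrite -subn1 natrB// ltnW.
have dA : (A.-1 - d)%:R = A%:R - 1 - d%:R :> R.
  by rewrite natrB 1?ltnW// -subn1 natrB//; move: d2; lia.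
have dm0 : 0 < (d.-1)%:R :> R by rewrite ltr0n; move: d1; lia.
have dA0 : 0 < (A.-1 - d)%:R :> R by rewrite ltr0n subn_gt0.
set u := `|x.1 - y.1|.
have sinE : `|sin (pi * (x.1 - y.1))| = `|sin (pi * u)|.
  rewrite /u; have [h|h] := leP 0 (x.1 - y.1); first by rewrite (ger0_norm h).
  by rewrite (ltr0_norm h) mulrN sinN normrN.
have dE : d%:R = `|i%:R - i'%:R| := natr_gap R i i'.
have uA : `|x.1 * A%:R - y.1 * A%:R| = u * A%:R.
  by rewrite -mulrBl normrM (ger0_norm (ltW a0)).
move: x1 x2 y1 y2; rewrite !ler_pdivrMr// !ler_pdivlMr// -!natr1 => x1 x2 y1 y2.
have close : `|(x.1 * A%:R - y.1 * A%:R) - (i%:R - i'%:R)| <= 1.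
  by rewrite ler_norml; apply/andP; split; lra.
have u1 : (d.-1)%:R <= u * A%:R.
  rewrite dm dE -uA; move: (ler_normB (x.1 * A%:R - y.1 * A%:R)
    ((x.1 * A%:R - y.1 * A%:R) - (i%:R - i'%:R))).
  by rewrite opprB addrC subrK; lra.
have u2 : (A.-1 - d)%:R <= (1 - u) * A%:R.
  rewrite dA mulrBl mul1r dE -uA.
  have := ler_normD ((x.1 * A%:R - y.1 * A%:R) - (i%:R - i'%:R)) (i%:R - i'%:R).
  by rewrite subrK; lra.
have u01 : 0 < u < 1.
  rewrite -(pmulr_lgt0 _ a0) (lt_le_trans dm0 u1) /=.
  by rewrite -subr_gt0 -(pmulr_lgt0 _ a0) (lt_le_trans dA0 u2).
case/andP: (u01) => u0 ult1.
have s0 : 0 < sin (pi * u).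
  by apply: sin_gt0_pi; rewrite mulr_gt0 ?pi_gt0//= gtr_pMr// pi_gt0.
rewrite sinE gtr0_norm//; split=> //.
apply: le_trans (inv_sin_pi_le u01) _.
rewrite mulrDr; apply: lerD.
  by rewrite -lef_pV2 ?posrE ?divr_gt0 ?invr_gt0// invf_div invrK ler_pdivrMr.
rewrite -lef_pV2 ?posrE ?divr_gt0 ?invr_gt0 ?subr_gt0//.
by rewrite invf_div invrK ler_pdivrMr.
Qed.

(** One summand for each of the cases: adjacent columns, first or second cell polar, and the rest. A
    polar row is paired with the diameter of the other cell, so that its row sum is a count of polar
    rows times a bounded sum. *)
Lemma mixdiff_cell_le (R : realType) (b A B i j i' j' : nat) (x x' y y' : R * R)
  (D := 4 + 8 * b%:R) (q := rowq R B j) (q' := rowq R B j') :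
  (0 < A)%N -> (B <= b * A)%N -> (j < B)%N -> (j' < B)%N ->
  cell A B i j x -> cell A B i j x' -> cell A B i' j' y -> cell A B i' j' y' ->
  `|mixdiff (lift_sphere x) (lift_sphere x') (lift_sphere y) (lift_sphere y')| <=
  (near_col A (gap i i'))%:R * (2 * D / q') +
  (polar B j)%:R * (2 * D / q') + (polar B j')%:R * (2 * D / q) +
  A%:R * gap_weight R A (gap i i') *
    (2 * D ^+ 2 * B%:R * ((q * Num.sqrt q)^-1 * (q' * Num.sqrt q')^-1)).
Proof.
move=> A0 BA jB jB' cx cx' cy cy'.
have q0 : 0 < q := rowq_gt0 R jB; have q0' : 0 < q' := rowq_gt0 R jB'.
have D0 : 0 < D by rewrite ltr_pwDl// mulr_ge0.
have dx := cell_diam_le A0 BA jB cx cx'; have dy := cell_diam_le A0 BA jB' cy cy'.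
rewrite -/D -/q -/q' in dx dy.
set M := `|_|.
have Mx : M <= 2 * D / q.
  by apply: (le_trans (mixdiff_le_l _ _ _ _)); rewrite -mulrA ler_pM2l.
have My : M <= 2 * D / q'.
  by apply: (le_trans (mixdiff_le_r _ _ _ _)); rewrite -mulrA ler_pM2l.
set K := 2 * D ^+ 2 * _ * _.
have K0 : 0 <= K.
  apply: mulr_ge0; first by apply: mulr_ge0 => //; rewrite mulr_ge0 ?sqr_ge0.
  by rewrite mulr_ge0// invr_ge0 mulr_ge0 ?sqrtr_ge0// ltW.
set T := A%:R * _ * _.
have T0 : 0 <= T by rewrite mulr_ge0// mulr_ge0 ?gap_weight_ge0.
have X0 : 0 <= 2 * D / q by rewrite divr_ge0 ?mulr_ge0// ltW.
have Y0 : 0 <= 2 * D / q' by rewrite divr_ge0 ?mulr_ge0// ltW.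
case: (boolP (near_col _ _)) => [_|far]; case: (boolP (polar B j)) => [_|pj];
  case: (boolP (polar B j')) => [_|pj'];
  rewrite ?mul1r ?mul0r ?add0r ?addr0; try lra.
(* Only far columns and nonpolar rows remain: [mixdiff_le] is divided by the lower bound 2 sqrt (q
   q') s / B of the distance. *)
have [s0 hs] := cell_sin_le far cx cy.
set s := `|sin _| in s0 hs.
have P := parallel_ge jB pj cx.2; have P' := parallel_ge jB' pj' cy.2.
have b0 : 0 < B%:R :> R by rewrite ltr0n (leq_trans _ jB).
have dge : 2 * (Num.sqrt q * Num.sqrt q' / B%:R) * s <=
    enorm (lift_sphere x - lift_sphere y).
  apply: le_trans (lift_sphere_dist_ge x y); rewrite ler_pM2r// ler_pM2l//.
  have -> : Num.sqrt q * Num.sqrt q' / B%:R = Num.sqrt (q / B%:R * (q' / B%:R)).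
    rewrite mulf_div -expr2 sqrtrM ?mulr_ge0 ?(ltW q0) ?(ltW q0')//.
    by rewrite sqrtrM ?(ltW q0)// sqrtrV ?exprn_ge0// ?sqrtr_sqr ?ger0_norm// ltW.
  by apply: ler_wsqrtr; apply: ler_pM => //; rewrite divr_ge0// ltW.
have main : 2 * (Num.sqrt q * Num.sqrt q' / B%:R) * s * M <= 4 * (D / q * (D / q')).
  apply: (@le_trans _ _ (4 * (enorm (lift_sphere x - lift_sphere x') *
    enorm (lift_sphere y - lift_sphere y')))).
    by apply: le_trans (mixdiff_le _ _ _ _); rewrite ler_wpM2r ?normr_ge0.
  by rewrite ler_pM2l// ler_pM ?enorm_ge0.
have r0 : 0 < Num.sqrt q by rewrite sqrtr_gt0.
have r0' : 0 < Num.sqrt q' by rewrite sqrtr_gt0.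
apply: (@le_trans _ _ (s^-1 * K)); last by rewrite ler_wpM2r.
rewrite ler_pdivlMl// /K.
have c0 : 0 < 2 * (Num.sqrt q * Num.sqrt q' / B%:R).
  by rewrite mulr_gt0 ?divr_gt0 ?mulr_gt0.
rewrite -(ler_pM2l c0) [leLHS]mulrA; apply: (le_trans main).
move: r0 r0'; set r := Num.sqrt q; set r' := Num.sqrt q' => r0 r0'.
rewrite le_eqVlt; apply/orP; left; apply/eqP.
by field; rewrite !gt_eqF.
Qed.

Lemma sum_pair_factor (R : realType) (A B : nat) (a b : nat -> nat -> R) :
  \sum_(k : 'I_A * 'I_B) \sum_(l : 'I_A * 'I_B) a k.1 l.1 * b k.2 l.2 =
  (\sum_(i < A) \sum_(i' < A) a i i') * (\sum_(j < B) \sum_(j' < B) b j j').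
Proof.
rewrite -(pair_bigA _ (fun (i : 'I_A) (j : 'I_B) =>
  \sum_(l : 'I_A * 'I_B) a i l.1 * b j l.2)) /=.
rewrite big_distrl /=; apply: eq_bigr => i _.
rewrite big_distrr /=; apply: eq_bigr => j _.
rewrite -(pair_bigA _ (fun (i' : 'I_A) (j' : 'I_B) => a i i' * b j j')) /=.
by rewrite big_distrl /=; apply: eq_bigr => i' _; rewrite big_distrr.
Qed.

Lemma sum_eq_ord (R : realType) (A c : nat) :
  \sum_(d < A) (d == c :> nat)%:R = (c < A)%N%:R :> R.
Proof.
elim: A => [|A IHA]; first by rewrite big_ord0.
rewrite big_ord_recr /= IHA ltnS.
by case: (ltngtP c A) => _; rewrite ?addr0 ?add0r.
Qed.

Lemma sum_near_col_le (R : realType) (A : nat) :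
  \sum_(d < A) (near_col A d)%:R <= 3 :> R.
Proof.
apply: (@le_trans _ _ (\sum_(d < A) ((d == 0%N :> nat)%:R +
    (d == 1%N :> nat)%:R + (d == A.-1 :> nat)%:R))).
  apply: ler_sum => d _; rewrite -!natrD ler_nat /near_col.
  by have := ltn_ord d; lia.
rewrite !big_split /= !sum_eq_ord -!natrD ler_nat.
by do 3!case: (_ < _)%N.
Qed.

Lemma sum_polar_le (R : realType) (B : nat) :
  \sum_(j < B) (polar B j)%:R <= 2 :> R.
Proof.
apply: (@le_trans _ _ (\sum_(j < B) ((j == 0%N :> nat)%:R +
    (j == B.-1 :> nat)%:R))).
  apply: ler_sum => j _; rewrite -!natrD ler_nat /polar.
  by have := ltn_ord j; lia.
rewrite !big_split /= !sum_eq_ord -!natrD ler_nat.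
by do 2!case: (_ < _)%N.
Qed.

(** Both halves are harmonic sums with shifted or reversed index, where 0^-1 counts as 0. *)
Lemma sum_gap_weight_le (R : realType) (A : nat) : (0 < A)%N ->
  \sum_(d < A) gap_weight R A d <= 2 * (1 + ln A%:R).
Proof.
move=> A0; have h := harmonic_le_ln R A0.
have inv n : \sum_(d < n) d%:R^-1 <= \sum_(d < n) d.+1%:R^-1 :> R.
  case: n => [|n]; first by rewrite !big_ord0.
  rewrite big_ord_recl invr0 add0r [leRHS]big_ord_recr /=.
  by rewrite lerDl invr_ge0.
rewrite big_split mulr_natl mulr2n /=; apply: lerD; apply: le_trans h.
  case: A {A0} => [|A]; first by rewrite !big_ord0.
  rewrite big_ord_recl /= invr0 add0r; apply: (le_trans (inv A)).
  by rewrite [leRHS]big_ord_recr /= lerDl invr_ge0.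
apply: le_trans (inv A); rewrite le_eqVlt; apply/orP; left; apply/eqP.
rewrite (reindex_inj rev_ord_inj) /=; apply: eq_bigr => j _.
by congr (_%:R^-1); have := ltn_ord j; lia.
Qed.

Lemma sum_col_le (R : realType) (A : nat) (g : nat -> R) (c : R) :
  (forall d, 0 <= g d) -> \sum_(d < A) g d <= c ->
  \sum_(i < A) \sum_(k < A) g (gap i k) <= A%:R * (2 * c).
Proof.
move=> g0 gc; rewrite -[in leRHS](card_ord A) mulr_natl -sumr_const.
apply: ler_sum => i _; apply: le_trans (sum_gap_le g0 (ltn_ord i)) _.
by rewrite ler_pM2l.
Qed.

(** The four terms of [mixdiff_cell_le] are summed separately: adjacent columns give 48 D and the
    polar rows 16 D twice, in total 80 D; the far pairs give 4 (1 + ln A) times 2 * 16^2 * D^2. *)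
Lemma sum_mixdiff_le (R : realType) (b A B : nat) (z w : 'I_A * 'I_B -> R * R)
  (D := 4 + 8 * b%:R : R) :
  (0 < A)%N -> (A <= B)%N -> (B <= b * A)%N ->
  (forall k : 'I_A * 'I_B, cell A B k.1 k.2 (z k)) ->
  (forall k : 'I_A * 'I_B, cell A B k.1 k.2 (w k)) ->
  \sum_k \sum_l `|mixdiff (lift_sphere (z k)) (lift_sphere (w k))
      (lift_sphere (z l)) (lift_sphere (w l))| <=
  (A * B)%:R * (80 * D + 2048 * D ^+ 2 * (1 + ln (A * B)%:R)).
Proof.
move=> A0 AB BA hz hw; have B0 : (0 < B)%N by apply: leq_trans AB.
have a0 : 0 < A%:R :> R by rewrite ltr0n.
have b0 : 0 < B%:R :> R by rewrite ltr0n.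
have D0 : 0 < D by rewrite ltr_pwDl// mulr_ge0.
pose Y j : R := (rowq R B j * Num.sqrt (rowq R B j))^-1.
(* Every summand is written as a column function times a row function, if need be with column
   function 1, for [sum_pair_factor]. *)
pose T (i i' j j' : nat) : R :=
  (near_col A (gap i i'))%:R * (2 * D / rowq R B j') +
  1 * ((polar B j)%:R * (2 * D / rowq R B j')) +
  1 * ((2 * D / rowq R B j) * (polar B j')%:R) +
  A%:R * gap_weight R A (gap i i') * (2 * D ^+ 2 * B%:R * (Y j * Y j')).
apply: (@le_trans _ _ (\sum_(k : 'I_A * 'I_B) \sum_(l : 'I_A * 'I_B)
    T k.1 l.1 k.2 l.2)).
  apply: ler_sum => k _; apply: ler_sum => l _.
  rewrite /T !mul1r (mulrC (2 * D / rowq R B k.2)).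
  exact: mixdiff_cell_le.
under eq_bigr do rewrite !big_split /=.
rewrite !big_split /=.
rewrite (sum_pair_factor A B (fun i i' => (near_col A (gap i i'))%:R)
  (fun j j' => 2 * D / rowq R B j')).
rewrite (sum_pair_factor A B (fun i i' => 1)
  (fun j j' => (polar B j)%:R * (2 * D / rowq R B j'))).
rewrite (sum_pair_factor A B (fun i i' => 1)
  (fun j j' => (2 * D / rowq R B j) * (polar B j')%:R)).
rewrite (sum_pair_factor A B (fun i i' => A%:R * gap_weight R A (gap i i'))
  (fun j j' => 2 * D ^+ 2 * B%:R * (Y j * Y j'))).
have sq : \sum_(j < B) 2 * D / rowq R B j <= 8 * D.
  rewrite -mulr_sumr; have := sum_inv_rowq_le R B0.
  by rewrite -(ler_pM2l (_ : 0 < 2 * D)) ?mulr_gt0//; lra.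
have sq0 : 0 <= \sum_(j < B) 2 * D / rowq R B j.
  by apply: sumr_ge0 => j _; rewrite divr_ge0 ?sqrtr_ge0// mulr_ge0// ltW.
have A2 : A%:R * A%:R <= (A * B)%:R :> R by rewrite -natrM ler_nat leq_mul.
have one : \sum_(i < A) \sum_(i' < A) (1 : R) = A%:R * A%:R.
  by rewrite !sumr_const card_ord mulr_natr.
have T1 : (\sum_(i < A) \sum_(i' < A) (near_col A (gap i i'))%:R) *
    (\sum_(j < B) \sum_(j' < B) 2 * D / rowq R B j') <= (A * B)%:R * (48 * D).
  have -> : (A * B)%:R * (48 * D) = A%:R * (2 * 3) * (B%:R * (8 * D)).
    by rewrite natrM; ring.
  apply: ler_pM.
  - by do 2!(apply: sumr_ge0 => ? _).
  - by apply: sumr_ge0.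
  - apply: (@sum_col_le R A (fun d => (near_col A d)%:R)) => //.
    exact: sum_near_col_le.
  - by rewrite sumr_const card_ord -[leLHS]mulr_natl ler_pM2l.
have T2 : (\sum_(i < A) \sum_(i' < A) (1 : R)) *
    (\sum_(j < B) \sum_(j' < B) (polar B j)%:R * (2 * D / rowq R B j')) <=
    (A * B)%:R * (16 * D).
  rewrite one -big_distrlr /=; apply: ler_pM.
  - by rewrite mulr_ge0.
  - by rewrite mulr_ge0// sumr_ge0.
  - exact: A2.
  - rewrite (_ : 16 * D = 2 * (8 * D)); last by ring.
    by apply: ler_pM; [exact: sumr_ge0|exact: sq0|exact: sum_polar_le|exact: sq].
have T3 : (\sum_(i < A) \sum_(i' < A) (1 : R)) *
    (\sum_(j < B) \sum_(j' < B) 2 * D / rowq R B j * (polar B j')%:R) <=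
    (A * B)%:R * (16 * D).
  rewrite one -big_distrlr /=; apply: ler_pM.
  - by rewrite mulr_ge0.
  - by rewrite mulr_ge0// sumr_ge0.
  - exact: A2.
  - rewrite (_ : 16 * D = 8 * D * 2); last by ring.
    by apply: ler_pM; [exact: sq0|exact: sumr_ge0|exact: sq|exact: sum_polar_le].
have lnA : ln A%:R <= ln (A * B)%:R :> R.
  by rewrite ler_ln ?posrE ?ltr0n ?muln_gt0 ?A0// ler_nat leq_pmulr.
have lnA0 : 0 <= ln A%:R :> R by rewrite ln_ge0// ler1n.
have SY := sum_inv_rowq32_le R B0.
have SY0 : 0 <= \sum_(j < B) Y j.
  by apply: sumr_ge0 => j _; rewrite invr_ge0 mulr_ge0 ?sqrtr_ge0.
have T4 : (\sum_(i < A) \sum_(i' < A) A%:R * gap_weight R A (gap i i')) *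
    (\sum_(j < B) \sum_(j' < B) 2 * D ^+ 2 * B%:R * (Y j * Y j')) <=
    (A * B)%:R * (2048 * D ^+ 2 * (1 + ln (A * B)%:R)).
  apply: (@le_trans _ _ ((A%:R * A%:R) * (2048 * D ^+ 2 * (1 + ln A%:R))));
    last first.
    have E0 : 0 < 2048 * D ^+ 2.
      by apply: mulr_gt0; [exact: ltr0n|exact: exprn_gt0].
    move: E0; move: (2048 * D ^+ 2) => E E0; apply: ler_pM; [| |exact: A2|].
    - by rewrite mulr_ge0.
    - by apply: mulr_ge0; [exact: ltW|exact: addr_ge0].
    - by rewrite ler_pM2l ?lerD2l.
  have -> : A%:R * A%:R * (2048 * D ^+ 2 * (1 + ln A%:R)) =
      A%:R * (A%:R * (2 * (2 * (1 + ln A%:R)))) * (512 * D ^+ 2) by ring.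
  apply: ler_pM.
  - by do 2!(apply: sumr_ge0 => ? _); rewrite mulr_ge0 ?gap_weight_ge0.
  - do 2!(apply: sumr_ge0 => ? _); apply: mulr_ge0.
      by apply: mulr_ge0 => //; rewrite mulr_ge0 ?sqr_ge0.
    by rewrite mulr_ge0 ?invr_ge0 ?mulr_ge0 ?sqrtr_ge0.
  - under eq_bigr do rewrite -mulr_sumr.
    rewrite -mulr_sumr ler_pM2l//; apply: (@sum_col_le R A (gap_weight R A)).
      exact: gap_weight_ge0.
    exact: sum_gap_weight_le.
  - under eq_bigr do rewrite -mulr_sumr.
    rewrite -mulr_sumr -big_distrlr /=.
    apply: (@le_trans _ _ (2 * D ^+ 2 * B%:R *
      ((16 / Num.sqrt B%:R) * (16 / Num.sqrt B%:R)))).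
      rewrite ler_wpM2l//; last exact: ler_pM.
      by apply: mulr_ge0 => //; rewrite mulr_ge0 ?sqr_ge0.
    rewrite -expr2 expr_div_n sqr_sqrtr// le_eqVlt; apply/orP; left; apply/eqP.
    by field; rewrite gt_eqF.
lra.
Qed.

(** * The worst-case error of nets *)

(** A net point is chosen in each half-open cell. These cells are disjoint, so the choice is
    injective, and A B = b^m makes it bijective. *)
Lemma net_cell_enum (R : realType) (b m : nat) (x : nat -> R * R)
  (P := [set x n | n in `I_(b ^ m)%N]) (A := (b ^ m./2)%N)
  (B := (b ^ (m - m./2))%N) :
  is_net b m P ->
  exists2 s : 'I_A * 'I_B -> 'I_(b ^ m), bijective s &
    forall k : 'I_A * 'I_B, cell A B k.1 k.2 (x (s k)).
Proof.
move=> [_ _ net].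
have mE : (m./2 + (m - m./2) = m)%N by have := odd_double_half m; lia.
have AB : (A * B = b ^ m)%N by rewrite -expnD mE.
have /choice [s hs] : forall k : 'I_A * 'I_B, exists n : 'I_(b ^ m),
    k.1%:R / A%:R <= (x n).1 < k.1.+1%:R / A%:R /\
    k.2%:R / B%:R <= (x n).2 < k.2.+1%:R / B%:R.
  move=> [i j].
  have [y [[[n nN <-] hy] _]] := net _ _ _ _ mE (ltn_ord i) (ltn_ord j).
  by exists (Ordinal nN).
exists s; last first.
  by move=> k; have [/andP[? /ltW ?] /andP[? /ltW ?]] := hs k; split; apply/andP.
apply: inj_card_bij; last by rewrite card_prod !card_ord AB.
have same (n i k : nat) (t : R) : i%:R / n%:R <= t < i.+1%:R / n%:R ->
    k%:R / n%:R <= t < k.+1%:R / n%:R -> (i <= k)%N.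
  move=> /andP[h1 h2] /andP[h3 h4]; have := le_lt_trans h1 h4.
  case: n {h1 h2 h3 h4} => [|n]; first by rewrite invr0 !mulr0 ltxx.
  by rewrite ltr_pM2r ?invr_gt0// ltr_nat ltnS.
move=> [i j] [i' j'] /= e.
have [h1 h2] := hs (i, j); have [h1' h2'] := hs (i', j').
rewrite -e /= in h1 h2 h1' h2'.
congr pair; apply/val_inj/eqP; rewrite eqn_leq.
  by rewrite (same _ _ _ _ h1 h1') (same _ _ _ _ h1' h1).
by rewrite (same _ _ _ _ h2 h2') (same _ _ _ _ h2' h2).
Qed.

Lemma worst_case_error_sqr_le (R : realType)
  (H : rkhs (@sphere R) (@distance_kernel R)) (Q : ('rV[R]_3 -> R) -> R) (c : R) :
  0 <= c ->
  (forall f : H, `|f| <= 1 ->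
    `|Q (rkhs_eval f) - sphere_integral (rkhs_eval f)| <= c) ->
  (worst_case_error H Q ^+ 2 <= (c ^+ 2)%:E)%E.
Proof.
move=> c0 hc; set W := worst_case_error H Q.
have Wc : (W <= c%:E)%E by apply/ereal_supP => _ [f f1 <-]; rewrite lee_fin hc.
(* Squaring is monotone only on nonnegative values; the zero function witnesses that the supremum is
   one. *)
have W0 : (0 <= W)%E.
  apply: (@le_trans _ _
    `|Q (rkhs_eval (0 : H)) - sphere_integral (rkhs_eval (0 : H))|%:E).
    by rewrite lee_fin.
  by apply: ereal_sup_ubound; exists 0 => //=; rewrite normr0 ler01.
by rewrite expe2 EFin_expe expe2; apply: lee_pmul.
Qed.

Lemma quadrature_reindex (R : realType) (N : nat) (T : finType)
  (z : nat -> 'rV[R]_3)  (s : T -> 'I_N) (f : 'rV[R]_3 -> R) : bijective s ->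
  quadrature N z f = N%:R^-1 * \sum_k f (z (s k)).
Proof.
move=> sb; rewrite /quadrature big_mkord; congr (_ * _).
by rewrite (reindex s)//; exact: onW_bij.
Qed.

Lemma net_worst_case_error (R : realType) (b m : nat) (x : nat -> R * R)
  (N := (b ^ m)%N) (D := 4 + 8 * b%:R : R)
  (H : rkhs (@sphere R) (@distance_kernel R)) :
  (0 < b)%N -> is_net b m [set x n | n in `I_N] ->
  (worst_case_error H (quadrature N (fun n => lift_sphere (x n))) ^+ 2 <=
    (N%:R^-1 * (80 * D + 2048 * D ^+ 2 * (1 + ln N%:R)))%:E)%E.
Proof.
move=> b0 /net_cell_enum.
set A := (b ^ m./2)%N; set B := (b ^ (m - m./2))%N => -[s sb hs].
have mE : (m./2 + (m - m./2) = m)%N by have := odd_double_half m; lia.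
have AB : (A * B = N)%N by rewrite -expnD mE.
have A0 : (0 < A)%N by rewrite expn_gt0 b0.
have B0 : (0 < B)%N by rewrite expn_gt0 b0.
have N0 : 0 < N%:R :> R by rewrite ltr0n expn_gt0 b0.
have leAB : (A <= B)%N by rewrite leq_pexp2l//; have := odd_double_half m; lia.
(* The exponents differ by at most 1, so the cells are square up to a factor b. *)
have leBA : (B <= b * A)%N.
  by rewrite -expnS leq_pexp2l//; have := odd_double_half m; lia.
set S := N%:R * (80 * D + 2048 * D ^+ 2 * (1 + ln N%:R)).
have hS w : (forall k : 'I_A * 'I_B, cell A B k.1 k.2 (w k)) ->
    \sum_k \sum_l `|mixdiff (lift_sphere (x (s k))) (lift_sphere (w k))
      (lift_sphere (x (s l))) (lift_sphere (w l))| <= S.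
  by move=> hw; rewrite /S -AB; exact: (sum_mixdiff_le A0 leAB leBA hs hw).
have S0 : 0 <= S.
  apply: le_trans (hS (fun k => x (s k)) hs).
  by do 2!(apply: sumr_ge0 => ? _).
have -> : N%:R^-1 * (80 * D + 2048 * D ^+ 2 * (1 + ln N%:R)) =
    (Num.sqrt S / N%:R) ^+ 2.
  rewrite expr_div_n sqr_sqrtr// /S expr2 invfM mulrACA mulfV ?gt_eqF// mul1r.
  by rewrite mulrC.
apply: worst_case_error_sqr_le; first by rewrite divr_ge0 ?sqrtr_ge0.
move=> f f1.
have bound (g : H) : `|g| <= 1 ->
    quadrature N (fun n => lift_sphere (x n)) (rkhs_eval g) -
    sphere_integral (rkhs_eval g) <= Num.sqrt S / N%:R.
  move=> g1; rewrite (quadrature_reindex _ _ sb).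
  by have := equal_weight_error_le A0 B0 g1 hs hS; rewrite AB.
have := bound (- f); rewrite normrN => /(_ f1).
rewrite sphere_integralN.
have -> : quadrature N (fun n => lift_sphere (x n)) (rkhs_eval (- f)) =
    - quadrature N (fun n => lift_sphere (x n)) (rkhs_eval f).
  rewrite !(quadrature_reindex _ _ sb) -mulrN -sumrN; congr (_ * _).
  apply: eq_bigr => k _; apply: rkhs_evalN.
  exact/lift_sphere_on/(cell_itv (ltn_ord k.2) (hs k)).
by have := bound f f1; rewrite ler_norml; lra.
Qed.

Unset Implicit Arguments.

Theorem corollary1 (R : realType) (b : nat) (hb : prime_power b)
  (F : finFieldType) (hF : #|F| = b)
  (code : F -> nat) (decode : nat -> F)
  (hcode : digit_bijection b code decode)
  (C1 C2 : forall m : nat, 'M[F]_m)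
  (hnet : forall m : nat, (0 < m)%N ->
     is_net b m (@digital_set R b F code decode m (C1 m) (C2 m)))
  (H : rkhs (@sphere R) (@distance_kernel R)) :
  exists C : R, \forall m \near \oo,
    let N := (b ^ m)%N in
    let x := digital_point R b code decode (C1 m) (C2 m) in
    let z := fun n => lift_sphere (x n) in
    (worst_case_error H (quadrature N z) ^+ 2 <= (C * (N%:R^-1 * ln N%:R))%:E)%E.
Proof.
have b2 : (1 < b)%N.
  case: hb => p [k [pp k0 ->]].
  by rewrite -(exp1n k) ltn_exp2r// prime_gt1.
pose D : R := 4 + 8 * b%:R.
(* For m >= 1 one has ln N >= ln b, so the constant terms are absorbed into multiples of ln N / ln
   b. *)
exists ((80 * D + 2048 * D ^+ 2) / ln b%:R + 2048 * D ^+ 2).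
exists 1%N => // m /= m0.
apply: le_trans (net_worst_case_error H (ltnW b2) (hnet m m0)) _.
rewrite lee_fin -/D [leRHS]mulrCA ler_wpM2l ?invr_ge0//.
have lnb : 0 < ln b%:R :> R by rewrite ln_gt0// ltr1n.
have lnN : ln b%:R <= ln (b ^ m)%:R :> R.
  rewrite ler_ln ?posrE ?ltr0n ?expn_gt0 ?(ltnW b2)// ler_nat.
  by rewrite -{1}(expn1 b) leq_pexp2l// ltnW.
have D0 : 0 < D by rewrite ltr_pwDl// mulr_ge0.
have K0 : 0 <= 2048 * D ^+ 2 by apply: mulr_ge0; [exact: ler0n|exact: sqr_ge0].
move: lnN K0; move: (ln (b ^ m)%:R) (2048 * D ^+ 2) => L K lnN K0.
have L1 : 1 <= L / ln b%:R by rewrite ler_pdivlMr// mul1r.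
have : (80 * D + K) * 1 <= (80 * D + K) * (L / ln b%:R).
  by rewrite ler_wpM2l//; lra.
by rewrite mulrDl mulrAC -mulrA mulr1; lra.
Qed.
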